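(* Let $u,v:\,]0,1[^2\to\,]0,\infty[$ be continuous functions such that for all $(p,q)\in\,]0,1[^2$ and all integers $n\ge 1$, $$\partial_p\theta_n(p,q)\le u(p,q)\,\partial_q\theta_n(p,q)\qquad\text{and}\qquad \partial_q\theta_n(p,q)\le v(p,q)\,\partial_p\theta_n(p,q).$$ Then the function $q_c:[p_{0,c},1]\to[0,1]$ is (strictly) decreasing and locally Lipschitz (hence continuous). Moreover, for all $p_{0,c}<p_1<p_2<1$, $$-\int_{p_1}^{p_2}u(p,q_c(p))\,\mathrm dp\;\le\; q_c(p_2)-q_c(p_1)\;\le\;-\int_{p_1}^{p_2}\frac{\mathrm dp}{v(p,q_c(p))}.$$
   Context: Combined site and bond Bernoulli percolation on $\mathbb Z^d$ ($d$ a positive integer), with site parameter $q\in[0,1]$ and bond parameter $p\in[0,1]$, is represented as site percolation on the following graph $G=(V,E)$: $V$ is the set of $x\in\mathbb Z^d$ having at most one odd coordinate, and edges join vertices at $\ell^1$-distance $1$. Let $V_0=2\mathbb Z^d$ (playing the role of the original sites) and $V_1=V\setminus V_0$ (playing the role of the original bonds). All vertices of $V$ are independently occupied (state $\omega(x)=1$) or empty (state $0$), with probability $q$ of being occupied for vertices in $V_0$ and probability $p$ for vertices in $V_1$. For an integer $n\ge 0$, $L_n=\{x\in V:\|x\|_\infty\le n\}$ and $\partial L_n=\{x\in V:\|x\|_\infty=n\}$. For $x\in V$ and $W\subset V$, $x\leftrightarrow W$ means that there is a path in $G$ from $x$ to a vertex of $W$ all of whose vertices (endpoints included) are occupied, with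 the convention that $x\leftrightarrow x$ always holds. $0\leftrightarrow\infty$ means that $0$ lies in an infinite connected component of occupied vertices. $\theta_n(p,q)=\mathbb P(0\leftrightarrow\partial L_n)$ and $\theta(p,q)=\mathbb P(0\leftrightarrow\infty)$. $p_{0,c}$ is the critical probability of standard Bernoulli bond percolation on $\mathbb Z^d$ (i.e. $p_{0,c}=\inf\{p:\theta(p,1)>0\}$). For $p_0\in[p_{0,c},1]$, $q_c(p_0)$ is the critical value of $q$ on the line $p=p_0$, i.e. $q_c(p_0)=\sup\{q\in[0,1]:\theta(p_0,q)=0\}$. Functions $u,v$ as in the claim exist; for example $u(p,q)=2d\,q/p$ and $v(p,q)=\frac{2(2d-1)p}{q(1-p)^{2d-1}}$ are admissible. *)

(* Defs.v *)
From HB Require Import structures.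
From mathcomp Require Import all_boot all_order all_algebra finmap.
From mathcomp Require Import all_classical all_reals all_analysis.

Set Implicit Arguments.
Unset Strict Implicit.
Unset Printing Implicit Defensive.

Import Order.TTheory GRing.Theory Num.Theory.
Import numFieldNormedType.Exports.

Local Open Scope classical_set_scope.
Local Open Scope ring_scope.

(* Site-bond percolation on Z^d as site percolation on the doubled lattice: the
   all-even point 2x is the site x, and a point with exactly one odd coordinate
   is the midpoint of two such points, i.e. the bond joining them. *)
Definition at_most_one_odd (d : nat) (x : 'rV[int]_d) : bool :=
  (#|[pred i : 'I_d | odd `|x ord0 i|%N]| <= 1)%N.

Definition vertex (d : nat) : Type := {x : 'rV[int]_d | at_most_one_odd x}.

Definition coord (d : nat) (x : vertex d) (i : 'I_d) : int := (val x) ord0 i.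

Fact origin_subproof (d : nat) : at_most_one_odd (0 : 'rV[int]_d).
Proof. by rewrite /at_most_one_odd eq_card0 // => i; rewrite !inE mxE. Qed.

Definition origin (d : nat) : vertex d := exist _ 0 (origin_subproof d).

Definition is_site (d : nat) (x : vertex d) : bool :=
  [forall i, ~~ odd `|coord x i|%N].

Definition l1_dist (d : nat) (x y : vertex d) : nat :=
  \sum_(i < d) `|coord x i - coord y i|%N.

Definition linf_norm (d : nat) (x : vertex d) : nat :=
  \max_(i < d) `|coord x i|%N.

Definition adjacent (d : nat) : rel (vertex d) :=
  [rel x y | l1_dist x y == 1%N].

Definition sphere (d n : nat) : set (vertex d) :=
  [set x | linf_norm x = n].
Arguments sphere d n : clear implicits.

Definition config (d : nat) : Type := vertex d -> bool.

Definition occupied_path (d : nat) (w : config d) (x y : vertex d) : Prop :=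
  exists s : seq (vertex d),
    [/\ path (@adjacent d) x s, all w (x :: s) & last x s = y].

(* The first disjunct is the convention that a vertex, even an empty one, is
   always connected to itself. *)
Definition connected_to (d : nat) (w : config d) (x : vertex d)
    (W : set (vertex d)) : Prop :=
  W x \/ exists2 y, W y & occupied_path w x y.

(* The cluster of an empty vertex is empty, since the path from x includes x. *)
Definition cluster (d : nat) (w : config d) (x : vertex d) : set (vertex d) :=
  [set y | occupied_path w x y].

(* Product sigma-algebra on {0,1}^V, generated by the coordinate maps. *)
Definition coordinate_events (d : nat) : set (set (config d)) :=
  [set [set w : config d | w x] | x in [set: vertex d]].

Definition config_space (d : nat) := g_sigma_algebraType (@coordinate_events d).

Definition mutually_independent (disp : measure_display)
    (T : measurableType disp) (R : realType) (P : probability T R)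
    (I : choiceType) (X : I -> T -> bool) : Prop :=
  forall (J : {fset I}) (B : I -> set bool),
    P (\bigcap_(i in [set` J]) (X i @^-1` B i)) =
    (\prod_(i <- J) P (X i @^-1` B i))%E.

(* P is the law of the percolation configuration with bond parameter p and
   site parameter q; being determined on cylinders, it is unique. *)
Definition site_bond_law (d : nat) (R : realType) (p q : R)
    (P : probability (config_space d) R) : Prop :=
  (forall x : vertex d,
     P [set w : config d | w x] = (if is_site x then q else p)%:E) /\
  mutually_independent P (fun (x : vertex d) (w : config d) => w x).

Definition site_bond_percolation (d : nat) (R : realType)
    (Pr : R -> R -> probability (config_space d) R) : Prop :=
  forall p q : R, 0 <= p <= 1 -> 0 <= q <= 1 -> site_bond_law p q (Pr p q).

Definition theta_n (d : nat) (R : realType)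
    (Pr : R -> R -> probability (config_space d) R) (n : nat) (p q : R) : R :=
  fine (Pr p q [set w : config d | connected_to w (origin d) (sphere d n)]).

Definition theta (d : nat) (R : realType)
    (Pr : R -> R -> probability (config_space d) R) (p q : R) : R :=
  fine (Pr p q [set w : config d | infinite_set (cluster w (origin d))]).

Definition p0c (d : nat) (R : realType)
    (Pr : R -> R -> probability (config_space d) R) : R :=
  inf [set p : R | 0 <= p <= 1 /\ 0 < theta Pr p 1].

Definition qc (d : nat) (R : realType)
    (Pr : R -> R -> probability (config_space d) R) (p0 : R) : R :=
  sup [set q : R | 0 <= q <= 1 /\ theta Pr p0 q = 0].

Definition open_square (R : realType) : set (R * R) :=
  `]0, 1[%classic `*` `]0, 1[%classic.
Arguments open_square R : clear implicits.

(* Main.v *)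
(** Write [theta_n] for the probability of the arm event [0 <-> dL_n], a
    polynomial in [(p, q)] decreasing to [theta] as [n] grows.

    Inside the open square the two differential inequalities say that [theta_n]
    is monotone along short segments: nonincreasing in the direction [(1, -k)]
    when [k > u], nondecreasing in the direction [(1, -k)] when [1 / k > v].
    Letting [n] tend to infinity, the slopes of [q_c] near [p] lie between
    [- u(p, q_c(p)) - o(1)] and [- 1 / v(p, q_c(p)) + o(1)], and the integral
    inequalities follow by a compactness argument on [[p_1, p_2]].

    Nothing is assumed about [u] and [v] at the boundary of the square, where
    [q_c] is controlled by two couplings instead.  Attributing each bond to one
    of its endpoints gives [theta(p, q c^(2d)) <= theta(p c, q)], whence the
    Lipschitz bound on [[p_{0,c}, 1]] and [q_c(p_{0,c}) = 1].  Realizing an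
    empty site by closing all the bonds around it gives
    [theta(p c^(2d), 1) <= theta(p, 1 - (1 - c)^(2d))], whence [q_c(p) < 1] for
    [p > p_{0,c}].  Counting paths gives [p_{0,c} > 0] and [q_c > 0]. *)
From HB Require Import structures.
From mathcomp Require Import all_boot all_order all_algebra finmap.
From mathcomp Require Import all_classical all_reals all_analysis.
From mathcomp Require Import ring lra zify.
Require Import Defs.
Set Implicit Arguments.
Unset Strict Implicit.
Unset Printing Implicit Defensive.
Import Order.TTheory GRing.Theory Num.Theory.
Import numFieldNormedType.Exports.
Local Open Scope classical_set_scope.
Local Open Scope ring_scope.

(** * Bernoulli expectations over a finite list of vertices *)

Definition set_at (V : eqType) (T : Type) (w : V -> T) (x : V) (b : T) : V -> T :=
  fun y => if y == x then b else w y.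

Lemma set_atE (V : eqType) T (w : V -> T) x b : set_at w x b x = b.
Proof. by rewrite /set_at eqxx. Qed.

Lemma set_at_neq (V : eqType) T (w : V -> T) x y b : y != x -> set_at w x b y = w y.
Proof. by rewrite /set_at => /negbTE ->. Qed.

Lemma set_at_id (V : eqType) T (w : V -> T) x : set_at w x (w x) = w.
Proof. by apply/funext => y; rewrite /set_at; case: eqP => // ->. Qed.

Lemma set_at_set (V : eqType) T (w : V -> T) x b c : set_at (set_at w x b) x c = set_at w x c.
Proof. by apply/funext => y; rewrite /set_at; case: eqP. Qed.

Lemma set_atC (V : eqType) T (w : V -> T) x y b c : x != y ->
  set_at (set_at w x b) y c = set_at (set_at w y c) x b.
Proof.
move=> xy; apply/funext => z; rewrite /set_at.
by case: (eqVneq z y) => // ->; rewrite eq_sym (negbTE xy).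
Qed.

Section bernoulli_expectation.
Variables (R : realType) (V : eqType).
Implicit Types (s : seq V) (r : V -> R) (A : (V -> bool) -> Prop) (w : V -> bool).

(* Probability of [A] when the states of the vertices in [s] are resampled
   independently, [x] being occupied with probability [r x], and all the other
   vertices keep their state in [w]. *)
Fixpoint bern s r A w : R :=
  if s is x :: s' then
    r x * bern s' r A (set_at w x true) + (1 - r x) * bern s' r A (set_at w x false)
  else (`[< A w >])%:R.

Definition increasing_event A :=
  forall w w', (forall x, w x -> w' x) -> A w -> A w'.

Lemma eq_bern s r r' A w : {in s, r =1 r'} -> bern s r A w = bern s r' A w.
Proof.
elim: s w => //= x s IH w rr'.
have rs : {in s, r =1 r'} by move=> y ys; apply: rr'; rewrite inE ys orbT.
by rewrite (rr' x) ?mem_head// !IH.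
Qed.

(** Conditioning on the state of [x], which is resampled at most once since [s] has no repetition;
    when [x] is not in [s] the three expectations coincide. *)
Lemma bern_affine s r A w x : uniq s ->
  bern s r A w = r x * bern s (set_at r x 1) A w +
                 (1 - r x) * bern s (set_at r x 0) A w.
Proof.
elim: s w => [|y s IH] w /=; first by move=> _; ring.
move=> /andP[ys us]; have [yx|yx] := eqVneq y x; last first.
  rewrite !set_at_neq// (IH (set_at w y true))// (IH (set_at w y false))//; ring.
subst y; rewrite !set_atE subr0 subrr !mul0r !mul1r addr0 add0r.
have rs b : {in s, r =1 set_at r x b}.
  by move=> z zs; rewrite set_at_neq//; apply: contraNneq ys => <-.
by rewrite (eq_bern _ _ (rs 1)) (eq_bern _ _ (rs 0)).
Qed.

Lemma bern_mono_state s r A (w w' : V -> bool) : increasing_event A ->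
  {in s, forall x, 0 <= r x <= 1} -> (forall x, w x -> w' x) ->
  bern s r A w <= bern s r A w'.
Proof.
move=> Ai; elim: s w w' => [|y s IH] w w' r01 ww' /=.
  case: asboolP => [Aw|_]; last by rewrite ler0n.
  by rewrite (asboolT (Ai _ _ ww' Aw)).
have rs : {in s, forall x, 0 <= r x <= 1}.
  by move=> z zs; apply: r01; rewrite inE zs orbT.
have /andP[ry0 ry1] := r01 y (mem_head _ _).
have IHb b : bern s r A (set_at w y b) <= bern s r A (set_at w' y b).
  by apply: IH => // z; rewrite /set_at; case: eqP => // _; exact: ww'.
by rewrite lerD// ler_wpM2l// subr_ge0.
Qed.

(** Raising the parameter of [x] changes the value by the increment times the gain from occupying
    [x], which is nonnegative for an increasing event; induction on [s] treats one vertex at a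
    time. *)
Lemma bern_mono s r r' A w : increasing_event A ->
  {in s, forall x, [/\ 0 <= r x, r x <= r' x & r' x <= 1]} ->
  bern s r A w <= bern s r' A w.
Proof.
move=> Ai; elim: s w => [//|x s IH] w /= r01.
have rs : {in s, forall x, [/\ 0 <= r x, r x <= r' x & r' x <= 1]}.
  by move=> y ys; apply: r01; rewrite inE ys orbT.
have [rx0 rx rx1] := r01 x (mem_head _ _).
apply: (@le_trans _ _ (r x * bern s r' A (set_at w x true) +
    (1 - r x) * bern s r' A (set_at w x false))).
  by rewrite lerD// ler_wpM2l ?IH//; lra.
rewrite -subr_ge0.
have -> : forall a b c d : R, (a * c + (1 - a) * d) - (b * c + (1 - b) * d) =
   (a - b) * (c - d) by move=> *; ring.
rewrite mulr_ge0// ?subr_ge0//; apply: bern_mono_state => // [y ys|y].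
  by have [? ? ?] := rs y ys; lra.
by rewrite /set_at; case: eqP.
Qed.

(** The configurations that resampling [s] from [w] can produce, a vertex of parameter 0 or 1 being
    deterministic. *)
Definition compatible s r w w' :=
  [/\ {in s, forall x, r x = 0 -> w' x = false},
      {in s, forall x, r x = 1 -> w' x = true} &
      forall x, x \notin s -> w' x = w x].

Lemma eq_bern_event s r A A' w :
  (forall w', compatible s r w w' -> (A w' <-> A' w')) ->
  bern s r A w = bern s r A' w.
Proof.
elim: s w => [|x s IH] w AA' /=.
  by rewrite (_ : A w = A' w)//; apply/propext/AA'; split.
(* The condition says that the branch giving [x] the state [b] has nonzero weight; branches of
   weight zero are never compared. *)
have step b : r x != (~~ b)%:R ->
    bern s r A (set_at w x b) = bern s r A' (set_at w x b).
  move=> rxb; apply: IH => w' [w0 w1 ws]; apply: AA'; split=> [y|y|y].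
  - rewrite inE; case: (boolP (y \in s)) => [ys _|ys]; first exact: w0.
    rewrite orbF => /eqP yx; subst y; rewrite ws// set_atE.
    by case: b rxb {ws} => // /eqP.
  - rewrite inE; case: (boolP (y \in s)) => [ys _|ys]; first exact: w1.
    rewrite orbF => /eqP yx; subst y; rewrite ws// set_atE.
    by case: b rxb {ws} => // /eqP.
  - by rewrite inE negb_or => /andP[yx ys]; rewrite ws// set_at_neq.
have [rx0|rx0] := eqVneq (r x) 0.
  by rewrite rx0 !mul0r !add0r step// rx0 eq_sym oner_neq0.
have [rx1|rx1] := eqVneq (r x) 1.
  by rewrite rx1 subrr !mul0r !addr0 step// rx1 oner_neq0.
by rewrite !step.
Qed.

Lemma bern_true s r w : bern s r (fun=> True) w = 1.
Proof.
elim: s w => [|x s IH] w /=; first by rewrite asboolT.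
by rewrite !IH; ring.
Qed.

Lemma bern_set_at s r A w x c : uniq s ->
  bern s (set_at r x c) A w = c * bern s (set_at r x 1) A w +
                 (1 - c) * bern s (set_at r x 0) A w.
Proof. by move=> us; rewrite (bern_affine _ _ _ x us) set_atE !set_at_set. Qed.

Lemma bern_state_indep s r A w e b : (forall w b, A (set_at w e b) <-> A w) ->
  bern s r A (set_at w e b) = bern s r A w.
Proof.
move=> Ae; elim: s w => [|y s IH] w /=.
  by rewrite (_ : A (set_at w e b) = A w)//; apply/propext/Ae.
have [->|ye] := eqVneq y e; first by rewrite !set_at_set.
by rewrite !(set_atC _ _ _ (_ : e != y)) 1?eq_sym// !IH.
Qed.

Lemma bern_param_indep s r A w e b b' : (forall w b, A (set_at w e b) <-> A w) ->
  bern s (set_at r e b) A w = bern s (set_at r e b') A w.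
Proof.
move=> Ae; elim: s w => [//|y s IH] w /=; rewrite !IH.
have [->|ye] := eqVneq y e; last by rewrite !set_at_neq.
by rewrite !set_atE !bern_state_indep//; ring.
Qed.

(** If [x] is empty then [e] has no influence. Hence erasing [x] is at least as harmful as erasing
    [e], and a factor [c] may be moved from the parameter of [x] to that of [e]. The hypothesis
    [w x = false] covers the case where [x] is not resampled. *)
Lemma bern_thin_endpoint s r A w x e c : uniq s -> increasing_event A -> e != x ->
  w x = false -> {in s, forall y, 0 <= r y <= 1} -> 0 <= r x <= 1 ->
  0 <= c <= 1 ->
  (forall w', w' x = false -> A (set_at w' e true) -> A (set_at w' e false)) ->
  bern s (set_at r x (c * r x)) A w <= bern s (set_at r e (c * r e)) A w.
Proof.
move=> us Ai ex wx r01 /andP[rx0 rx1] /andP[c0 c1] Ax.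
have xe : x != e by rewrite eq_sym.
(* [f a b] has parameter [a] at [x] and [b] at [e]; [fE] expands it over the four corners. *)
pose f a b := bern s (set_at (set_at r x a) e b) A w.
have fE a b : f a b = a * (b * f 1 1 + (1 - b) * f 1 0) +
                      (1 - a) * (b * f 0 1 + (1 - b) * f 0 0).
  have fb a' : f a' b = b * f a' 1 + (1 - b) * f a' 0 by rewrite /f bern_set_at.
  have fa b' : f a b' = a * f 1 b' + (1 - a) * f 0 b'.
    by rewrite /f !(set_atC _ _ _ xe) bern_set_at.
  by rewrite fb !fa; ring.
have -> : bern s (set_at r x (c * r x)) A w = f (c * r x) (r e).
  rewrite /f; congr bern; apply/funext => z; rewrite /set_at.
  by case: (eqVneq z e) => // ->; rewrite (negbTE ex).
have -> : bern s (set_at r e (c * r e)) A w = f (r x) (c * r e).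
  by rewrite /f set_at_id.
(* With parameter 0 the vertex [x] is empty, so [A] may be replaced by [A0], which ignores [e]. *)
have f0 : f 0 1 = f 0 0.
  pose A0 w := A (set_at w e false).
  have f0E b : f 0 b = bern s (set_at (set_at r x 0) e b) A0 w.
    apply: eq_bern_event => w' [w'0 _ w's]; split; last first.
      by apply: Ai => y; rewrite /set_at; case: eqP.
    move=> Aw'; apply: Ax; last first.
      by apply: Ai Aw' => y; rewrite /set_at; case: eqP.
    have [xs|xs] := boolP (x \in s); last by rewrite w's.
    by apply: w'0 => //; rewrite set_at_neq// set_atE.
  rewrite !f0E; apply: bern_param_indep => w' b.
  by rewrite /A0 set_at_set.
rewrite (fE (c * r x)) (fE (r x)).
have f10 : f 0 0 <= f 1 0.
  apply: bern_mono => // y ys; have /andP[? ?] := r01 y ys.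
  by rewrite /set_at; case: eqP => // _; case: eqP => // _; split=> //; lra.
(* The two sides differ by [(1 - c) * r x * (f 1 0 - f 0 0)]. *)
rewrite f0 -subr_ge0; set g00 := f 0 0 in f10 *; set g10 := f 1 0 in f10 *.
rewrite [leRHS](_ : _ = (1 - c) * r x * (g10 - g00)); last by ring.
by rewrite !mulr_ge0// ?subr_ge0.
Qed.

Definition thin_at (N : seq V) (c : R) r : V -> R :=
  fun y => if y \in N then c * r y else r y.

(* Thinning [N] by [c] amounts to erasing each vertex of [N] with probability
   [1 - c]: either they are all erased, or one forgets about the erasure. *)
Lemma bern_thin_mixture s r A w N c : uniq s -> uniq N -> increasing_event A ->
  {in s, forall y, 0 <= r y <= 1} -> 0 <= c <= 1 ->
  bern s (thin_at N c r) A w <=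
    (1 - c) ^+ size N * bern s (thin_at N 0 r) A w +
    (1 - (1 - c) ^+ size N) * bern s r A w.
Proof.
move=> us uN Ai + /andP[c0 c1]; elim: N uN r => [|x N IH] /=.
  move=> _ r r01; rewrite expr0 subrr mul0r addr0 mul1r.
  by rewrite (_ : thin_at [::] 0 r = r).
move=> /andP[xN uN] r r01; set k := size N.
have thinE a b : set_at (thin_at N a r) x b = thin_at N a (set_at r x b).
  apply/funext => y; rewrite /thin_at/= /set_at; case: eqVneq => // ->.
  by rewrite (negbTE xN).
have thin_cons a : thin_at (x :: N) a r = set_at (thin_at N a r) x (a * r x).
  by apply/funext => y; rewrite /thin_at/= /set_at inE; case: eqVneq => // ->.
have thinx : thin_at N c r x = r x by rewrite /thin_at (negbTE xN).
have r001 : {in s, forall y, 0 <= set_at r x 0 y <= 1}.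
  by move=> y ys; rewrite /set_at; case: eqP => // _; [rewrite lexx ler01 | exact: r01].
(* The head [x] is kept with probability [c] and erased with probability [1 - c]. *)
have -> : bern s (thin_at (x :: N) c r) A w =
    c * bern s (thin_at N c r) A w + (1 - c) * bern s (thin_at N c (set_at r x 0)) A w.
  rewrite thin_cons bern_set_at// -!thinE -[in X in _ = _ * X + _](set_at_id (thin_at N c r) x).
  rewrite thinx (bern_set_at _ _ _ _ (r x))//; ring.
rewrite (thin_cons 0) mul0r thinE.
have IHr := IH uN r r01; have IH0 := IH uN _ r001; rewrite -/k in IHr IH0.
have Y0 : bern s (set_at r x 0) A w <= bern s r A w.
  apply: bern_mono => // y ys; have /andP[? ?] := r01 y ys.
  by rewrite /set_at; case: eqP => // _; split.
have X1 : bern s (thin_at N 0 r) A w <= bern s r A w.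
  apply: bern_mono => // y ys; have /andP[? ?] := r01 y ys.
  by rewrite /thin_at; case: ifP => // _; rewrite ?mul0r; split.
have t01 : 0 <= (1 - c) ^+ k <= 1.
  by rewrite exprn_ge0 ?exprn_ile1//; lra.
rewrite exprS; move: t01 => /andP[]; set t := (1 - c) ^+ k in IHr IH0 * => t0 t1.
move: Y0 X1 IHr IH0; set Y := bern s r A w; set X := bern s (thin_at N 0 r) A w.
set Z := bern s (thin_at N 0 (set_at r x 0)) A w.
set Y0 := bern _ (set_at r x 0) _ _ => Y0Y XY IHr IH0.
have h1 := ler_wpM2l c0 IHr.
have c1' : 0 <= 1 - c by rewrite subr_ge0.
have h2 := ler_wpM2l c1' IH0.
apply: (le_trans (lerD h1 h2)); rewrite -subr_ge0.
rewrite [leRHS](_ : _ = c * t * (Y - X) + (1 - c) * (1 - t) * (Y - Y0)); last by ring.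
by rewrite addr_ge0// !mulr_ge0// subr_ge0.
Qed.

(** By [bern_thin_mixture] all of [N] is erased with weight [(1 - c) ^+ size N]; the state of [x] is
    then irrelevant, so [x] may be emptied instead. Emptying [x] with that probability leaves it the
    parameter on the right. *)
Lemma bern_thin_neighbours s r A w x N c : uniq s -> uniq N -> x \notin N ->
  increasing_event A -> {in N, forall y, w y = false} ->
  {in s, forall y, 0 <= r y <= 1} -> r x = 1 -> 0 <= c <= 1 ->
  (forall w', {in N, forall y, w' y = false} ->
     A (set_at w' x true) -> A (set_at w' x false)) ->
  bern s (thin_at N c r) A w <= bern s (set_at r x (1 - (1 - c) ^+ size N)) A w.
Proof.
move=> us uN xN Ai wN r01 rx c01 AN.
apply: (le_trans (bern_thin_mixture _ us uN Ai r01 c01)).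
rewrite [leRHS]bern_set_at// -[X in set_at r x X]rx set_at_id addrC lerD2l.
rewrite subKr ler_wpM2l//.
  by rewrite exprn_ge0// subr_ge0; case/andP: c01.
pose A0 w := A (set_at w x false).
have thin0E b : bern s (set_at (thin_at N 0 r) x b) A w =
                bern s (set_at (thin_at N 0 r) x b) A0 w.
  apply: eq_bern_event => w' [w'0 _ w's]; split; last first.
    by apply: Ai => y; rewrite /set_at; case: eqP.
  move=> Aw'; apply: AN => [y yN|]; last first.
    by apply: Ai Aw' => y; rewrite /set_at; case: eqP.
  have [ys|ys] := boolP (y \in s); last by rewrite w's// wN.
  apply: w'0 => //; rewrite set_at_neq; last by apply: contraNneq xN => <-.
  by rewrite /thin_at yN mul0r.
have A0x w' b : A0 (set_at w' x b) <-> A0 w' by rewrite /A0 set_at_set.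
(* With [N] erased the event no longer depends on [x], whose parameter can be lowered to 0 at no
   cost; restoring [N] afterwards only increases the value. *)
rewrite -[X in bern s X](set_at_id (thin_at N 0 r) x) thin0E.
rewrite (bern_param_indep _ _ _ _ 0 A0x) -thin0E.
apply: bern_mono => // y ys; have /andP[? ?] := r01 y ys.
rewrite /set_at; case: eqP => _; first by split.
by rewrite /thin_at; case: ifP => // _; rewrite ?mul0r; split.
Qed.

End bernoulli_expectation.

(** * From the finite recursion to the product measure *)

Section finitely_determined_events.
Variables (R : realType) (d : nat).
Implicit Types (P : probability (config_space d) R) (A : set (config d)).

Definition determined_by (S : set (vertex d)) A :=
  forall w w', (forall x, S x -> w x = w' x) -> A w -> A w'.

Lemma measurable_occupied (x : vertex d) (b : bool) :
  measurable ([set w | w x = b] : set (config_space d)).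
Proof.
have m1 : measurable ([set w | w x] : set (config_space d)).
  by apply: sub_sigma_algebra; exists x.
case: b; first exact: m1.
rewrite (_ : [set w | w x = false] = ~` [set w | w x]); first exact: measurableC.
by apply/seteqP; split=> w /=; [move=> ->|case: (w x)].
Qed.

Definition cylinder (J : {fset vertex d}) (w : config d) : set (config d) :=
  [set w' : config d | forall x, x \in J -> w' x = w x].

Lemma cylinder_prob P (r : vertex d -> R) (J : {fset vertex d}) w :
  (forall x, P [set w | w x] = (r x)%:E) ->
  mutually_independent P (fun (x : vertex d) (w : config d) => w x) ->
  measurable (cylinder J w : set (config_space d)) /\
  P (cylinder J w) = (\prod_(x <- J) (if w x then r x else 1 - r x))%:E.
Proof.
move=> Pr indep.
have -> : cylinder J w = \bigcap_(x in [set` J]) ((fun w => w x) @^-1` [set w x]).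
  by apply/seteqP; split=> w' /= h x; apply: h.
split.
  by apply: fin_bigcap_measurable => // x _; exact: measurable_occupied.
rewrite (indep J (fun x => [set w x])) -prodEFin; apply: eq_bigr => x _.
case: (w x); first exact: Pr.
transitivity (P (~` [set w | w x])).
  congr (P _); apply/seteqP; split=> w' /=; [by move=> ->|by case: (w' x)].
by rewrite probability_setC ?Pr//; exact: (measurable_occupied x true).
Qed.

(** Independence gives the law of cylinders; an event depending on finitely many vertices is cut
    into cylinders by fixing the states of [s] one at a time, which is the recursion of [bern]. The
    starting [w] is arbitrary because [s] contains every vertex on which [A] depends. *)
Lemma determined_event_prob P (r : vertex d -> R) (s : seq (vertex d)) A w :
  (forall x, P [set w | w x] = (r x)%:E) ->
  mutually_independent P (fun (x : vertex d) (w : config d) => w x) ->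
  uniq s -> determined_by [set` s] A ->
  measurable (A : set (config_space d)) /\ P A = (bern s r A w)%:E.
Proof.
move=> Pr indep us As.
(* [J] collects the vertices whose states are already fixed as in [w]. When [s] is exhausted, [A]
   contains the cylinder or is disjoint from it. *)
suff : forall J : {fset vertex d}, {in s, forall x, x \notin J} ->
    determined_by [set x | x \in s \/ x \in J] A ->
    measurable (A `&` cylinder J w : set (config_space d)) /\
    P (A `&` cylinder J w) =
      ((\prod_(x <- J) (if w x then r x else 1 - r x)) * bern s r A w)%:E.
  move=> /(_ fset0); rewrite big_seq_fset0 mul1r.
  rewrite (_ : cylinder fset0 w = setT) ?setIT; last first.
    by apply/seteqP; split=> // w' _ x; rewrite inE.
  by apply=> // w1 w2 w12; apply: As => x xs; apply: w12; left.
clear As; elim: s us w => [|x s IH] us w J sJ As /=.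
  have [Aw|Aw] := pselect (A w).
    rewrite (_ : A `&` cylinder J w = cylinder J w).
      by rewrite asboolT// mulr1; exact: cylinder_prob.
    apply/seteqP; split=> [w' []//|w' w'J]; split=> //; apply: As Aw => y.
    by move=> /= [//|yJ]; rewrite w'J.
  rewrite (_ : A `&` cylinder J w = set0).
    by rewrite asboolF// mulr0 measure0; split.
  apply/seteqP; split=> w' // -[Aw' w'J]; apply: Aw; apply: As Aw' => y.
  by move=> /= [//|yJ]; rewrite w'J.
have /andP[xs us'] := us.
have xJ : x \notin J by apply: sJ; rewrite mem_head.
have split_cyl b : A `&` cylinder (x |` J)%fset (set_at w x b) =
    (A `&` cylinder J w) `&` [set w' | w' x = b].
  apply/seteqP; split=> w' /=.
    move=> [Aw' w'J]; split; last by rewrite w'J ?set_atE// fset1U1.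
    split=> // y yJ; rewrite w'J ?set_at_neq//; last by rewrite fset1Ur.
    by apply: contraNneq xJ => <-.
  move=> [[Aw' w'J] w'x]; split=> // y; rewrite in_fset1U /set_at.
  by case: eqVneq => [->|_ /= yJ]; [rewrite w'x|exact: w'J].
have IHb b : measurable ((A `&` cylinder J w) `&` [set w' | w' x = b] : set (config_space d)) /\
    P ((A `&` cylinder J w) `&` [set w' | w' x = b]) =
    ((\prod_(x <- J) (if w x then r x else 1 - r x)) *
     ((if b then r x else 1 - r x) * bern s r A (set_at w x b)))%:E.
  rewrite -split_cyl; have [y ys|w1 w2 w12|mA ->] := IH us' (set_at w x b) (x |` J)%fset.
  - rewrite in_fset1U negb_or sJ ?inE ?ys ?orbT// andbT.
    by apply: contraNneq xs => <-.
  - apply: As => y /=; rewrite inE => h; apply: w12 => /=; rewrite in_fset1U.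
    by case: h => [/orP[->|->]|->]; [right|left|rewrite orbT; right].
  split=> //; congr (_%:E); rewrite big_fsetU1//= set_atE [in RHS]mulrCA -!mulrA.
  congr (_ * (_ * _)); apply: eq_fbigr => y yJ; rewrite set_at_neq//.
  by apply: contraNneq xJ => <-.
have [mt Pt] := IHb true; have [mf Pf] := IHb false.
have -> : A `&` cylinder J w = (A `&` cylinder J w `&` [set w' | w' x = true]) `|`
     (A `&` cylinder J w `&` [set w' | w' x = false]).
  by apply/seteqP; split=> [w' ?|w' [[]//|[]//]]; case E : (w' x); [left|right].
split; first exact: measurableU.
rewrite measureU//; first by apply: etrans (congr2 adde Pt Pf) _; rewrite /= mulrDr.
by apply/seteqP; split=> w' //= -[[_ ->] []].
Qed.

End finitely_determined_events.

(** * Geometry of the lattice and of the arm events *)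

Section lattice_geometry.
Variable d : nat.
Implicit Types x y z e : vertex d.

Lemma vertexP x y : (forall i, coord x i = coord y i) -> x = y.
Proof. by move=> xy; apply/val_inj/rowP => i; exact: xy. Qed.

Lemma odd_coord_unique x i j : odd `|coord x i|%N -> odd `|coord x j|%N -> i = j.
Proof.
move=> xi xj; have /card_le1_eqP := valP x; apply; rewrite inE//.
Qed.

Lemma adjacentP x y : adjacent x y ->
  exists2 k, `|coord x k - coord y k|%N = 1%N & forall j, j != k -> coord x j = coord y j.
Proof.
move=> /sum_nat_eq1[k [_ xk xj]]; exists k => // j jk.
by apply/eqP; rewrite -subr_eq0 -absz_eq0 xj.
Qed.

Lemma adjacent_sym x y : adjacent x y = adjacent y x.
Proof. by rewrite /adjacent/= /l1_dist; under eq_bigr do rewrite distnC. Qed.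

Lemma adjacent_neq x y : adjacent x y -> x != y.
Proof. by move=> /adjacentP[k xk _]; apply/eqP => xy; move: xk; rewrite xy subrr. Qed.

Lemma odd_step (a b : int) : `|a - b|%N = 1%N -> odd `|b|%N = ~~ odd `|a|%N.
Proof. lia. Qed.

Lemma siteP x : reflect (forall k, odd `|coord x k|%N = false) (is_site x).
Proof.
by apply: (iffP forallP) => h k; [rewrite (negbTE (h k))|rewrite h].
Qed.

Lemma bond_oddP x : reflect (exists k, odd `|coord x k|%N) (~~ is_site x).
Proof.
rewrite negb_forall; apply: (iffP existsP) => -[k xk]; exists k.
  by rewrite negbK in xk.
by rewrite negbK.
Qed.

(** Changing an even coordinate of a bond by one would create a second odd coordinate, so its
    neighbours are reached along its odd coordinate only. *)
Lemma adjacent_bond e z k : adjacent e z -> odd `|coord e k|%N ->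
  `|coord e k - coord z k|%N = 1%N /\ forall j, j != k -> coord e j = coord z j.
Proof.
move=> /adjacentP[j ej ei] ek; have [<-//|jk] := eqVneq j k.
have zk : odd `|coord z k|%N by rewrite -ei// eq_sym.
have zj : odd `|coord z j|%N.
  rewrite (odd_step ej); apply/negP => ej'.
  by rewrite (odd_coord_unique ej' ek) eqxx in jk.
by rewrite (odd_coord_unique zj zk) eqxx in jk.
Qed.

Lemma adjacent_site x y : adjacent x y -> is_site y = ~~ is_site x.
Proof.
move=> xy; have [xs|/bond_oddP[k xk]] := boolP (is_site x).
  have /adjacentP[k yk _] := xy.
  by apply/negbTE/bond_oddP; exists k; rewrite (odd_step yk) (siteP _ xs).
have [yk yj] := adjacent_bond xy xk.
apply/siteP => j; have [->|jk] := eqVneq j k; first by rewrite (odd_step yk) xk.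
rewrite -yj//; apply/negbTE/negP => xj.
by rewrite (odd_coord_unique xj xk) eqxx in jk.
Qed.

Lemma bond_neighbour_unique e x y z : ~~ is_site e ->
  adjacent e x -> adjacent e y -> adjacent e z -> y != x -> z != x -> y = z.
Proof.
move=> /bond_oddP[k ek] ex ey ez yx zx.
have [exk exj] := adjacent_bond ex ek.
have [eyk eyj] := adjacent_bond ey ek.
have [ezk ezj] := adjacent_bond ez ek.
have neq y' : adjacent e y' -> y' != x -> coord y' k != coord x k.
  move=> ey' y'x; apply: contraNneq y'x => y'k; apply/eqP/vertexP => j.
  by have [->//|jk] := eqVneq j k; rewrite -exj// (adjacent_bond ey' ek).2.
have := neq y ey yx; have := neq z ez zx => /eqP zk /eqP yk.
apply/vertexP => j; have [->|jk] := eqVneq j k; last by rewrite -eyj// -ezj.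
lia.
Qed.

Lemma leq_linf x i : (`|coord x i|%N <= linf_norm x)%N.
Proof. by rewrite /linf_norm; apply: leq_bigmax. Qed.

Lemma linf_leP x n : reflect (forall i, `|coord x i|%N <= n)%N (linf_norm x <= n)%N.
Proof. by apply: (iffP (bigmax_leqP _ _ _)) => h i; [exact: h|move=> _]. Qed.

Lemma linf_adjacent x y : adjacent x y -> (linf_norm y <= (linf_norm x).+1)%N.
Proof.
move=> /adjacentP[k xk xj]; apply/linf_leP => i.
have := leq_linf x i; have [->|ik] := eqVneq i k; last by rewrite xj//; lia.
lia.
Qed.

Lemma linf_origin : linf_norm (origin d) = 0%N.
Proof. by apply/eqP; rewrite -leqn0; apply/linf_leP => i; rewrite /coord/= mxE. Qed.

Lemma origin_site : is_site (origin d).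
Proof. by apply/siteP => i; rewrite /coord/= mxE. Qed.

(* The odd coordinate of a bond cannot realize an even norm. *)
Lemma linf_bond_endpoint e z : ~~ is_site e -> adjacent e z ->
  ~~ odd (linf_norm e) -> linf_norm z = linf_norm e.
Proof.
move=> /bond_oddP[k ek] ez en.
have [zk zj] := adjacent_bond ez ek.
have d0 : (0 < #|'I_d|)%N by apply/card_gt0P; exists k.
have [i ei] := bigop.eq_bigmax (fun i => `|coord e i|%N) d0.
have {}ei : linf_norm e = `|coord e i|%N by [].
have ik : i != k by apply/eqP => ik; move: en; rewrite ei ik ek.
apply/eqP; rewrite eqn_leq; apply/andP; split; last first.
  by rewrite ei zj//; exact: leq_linf.
apply/linf_leP => j; have [->|jk] := eqVneq j k; last by rewrite -zj//; exact: leq_linf.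
have := leq_linf e k; rewrite leq_eqVlt => /orP[/eqP ek'|]; last lia.
by move: en; rewrite -ek' ek.
Qed.

Definition unit_steps x : seq 'rV[int]_d :=
  [seq val x + b.1 *: delta_mx ord0 b.2 | b <- [seq (a, k) | a <- [:: 1; -1], k <- enum 'I_d]].

Definition neighbours x : seq (vertex d) :=
  [seq y <- undup (pmap insub (unit_steps x)) | adjacent x y].

Lemma mem_neighbours x y : (y \in neighbours x) = adjacent x y.
Proof.
rewrite mem_filter mem_undup; apply: andb_idr => xy.
rewrite (mem_pmap_sub (unit_steps x) y); have /adjacentP[k xk xj] := xy.
apply/mapP; exists (coord y k - coord x k, k).
  apply/allpairsP; exists (coord y k - coord x k, k); split=> //.
    rewrite !inE /=; lia.
  by rewrite mem_enum.
apply/rowP => j; rewrite !mxE eqxx/=.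
have [->|jk] := eqVneq j k; first by rewrite mulr1 addrC subrK.
by rewrite mulr0 addr0; symmetry; exact: xj.
Qed.

Lemma neighbours_uniq x : uniq (neighbours x).
Proof. by rewrite filter_uniq// undup_uniq. Qed.

Lemma size_neighbours x : (size (neighbours x) <= 2 * d)%N.
Proof.
rewrite size_filter (leq_trans (count_size _ _))//.
rewrite (leq_trans (size_undup _))// size_pmap (leq_trans (count_size _ _))//.
by rewrite !size_map size_allpairs/= size_enum_ord.
Qed.

Fact bond_has_endpoint e : ~~ is_site e -> exists z, adjacent e z.
Proof.
move=> /bond_oddP[k ek].
pose v : 'rV[int]_d := val e + delta_mx ord0 k.
have vE j : v ord0 j = coord e j + (j == k)%:R.
  by rewrite !mxE eqxx.
have vP : at_most_one_odd v.
  rewrite /at_most_one_odd eq_card0// => j; rewrite !inE vE.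
  have [->|jk] := eqVneq j k.
    by apply/negbTE; move: ek => /=; lia.
  rewrite addr0; apply/negP => ej.
  by rewrite (odd_coord_unique ej ek) eqxx in jk.
exists (exist _ v vP); apply/sum_nat_eq1; exists k.
have cE j : coord (exist _ v vP) j = v ord0 j by [].
split=> // [|j jk _]; rewrite cE vE ?eqxx ?(negbTE jk); lia.
Qed.

(** An arbitrary endpoint to which the bond is attributed; by [bond_has_endpoint] the default [e] is
    not returned when [e] is a bond. *)
Definition endpoint e : vertex d := head e (neighbours e).

Lemma endpointP e : ~~ is_site e -> adjacent e (endpoint e).
Proof.
move=> /bond_has_endpoint[z]; rewrite -mem_neighbours /endpoint => ze.
have : head e (neighbours e) \in neighbours e.
  by case: (neighbours e) ze => //= a s _; rewrite mem_head.
by rewrite mem_neighbours.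
Qed.

Lemma finite_box n : finite_set [set x : vertex d | (linf_norm x <= n)%N].
Proof.
pose g (f : {ffun 'I_d -> 'I_(2 * n).+1}) : vertex d :=
  insubd (origin d) (\row_i ((f i)%:Z - n%:Z)).
apply: (@sub_finite_set _ _ (g @` setT)); last exact/finite_image/finite_finset.
move=> x /= /linf_leP xn.
exists [ffun i => inord `|(coord x i + n%:Z)%R|%N] => //.
apply/val_inj; rewrite /g /insubd.
have -> : \row_i (([ffun i => inord `|(coord x i + n%:Z)%R|%N : 'I_(2 * n).+1] i)%:Z
    - n%:Z) = val x.
  apply/rowP => i; rewrite mxE ffunE inordK; last by have := xn i; lia.
  rewrite -/(coord x i); have := xn i; lia.
by rewrite valK.
Qed.

Definition box n : seq (vertex d) := fset_set [set x : vertex d | (linf_norm x <= n)%N].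

Lemma mem_box n x : (x \in box n) = (linf_norm x <= n)%N.
Proof. by rewrite in_fset_set; [apply: asboolb|exact: finite_box]. Qed.

Lemma box_uniq n : uniq (box n).
Proof. exact: fset_uniq. Qed.

End lattice_geometry.

(** * Clusters, arm events and walks from the origin *)

Section connectivity.
Variable d : nat.
Implicit Types (x y z e : vertex d) (w : config d).

(** Occupied paths from the origin, grown at their far end so that induction follows the exploration
    of the cluster. *)
Inductive reach w : vertex d -> Prop :=
| reach_origin : w (origin d) -> reach w (origin d)
| reach_step y z : reach w y -> adjacent y z -> w z -> reach w z.

Lemma reach_occupied w x : reach w x -> w x.
Proof. by case. Qed.

Lemma reachP w y : occupied_path w (origin d) y <-> reach w y.
Proof.
split=> [[s [ps ws <-]]|].
  have : reach w (origin d) by apply: reach_origin; case/andP: ws.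
  elim: s (origin d) ps ws => //= z s IH x /andP[xz zs] /and3P[wx wz ws] rx.
  by apply: IH => //; [rewrite wz|exact: reach_step rx xz wz].
elim=> [wo|x z _ [s [ps ws <-]] xz wz]; first by exists [::]; split=> //=; rewrite wo.
exists (rcons s z); split; last by rewrite last_rcons.
  by rewrite rcons_path ps.
by rewrite -rcons_cons all_rcons wz.
Qed.

Lemma reach_mono w w' y : (forall x, w x -> w' x) -> reach w y -> reach w' y.
Proof.
move=> ww'; elim=> [/ww'|x z _ rx xz /ww']; first exact: reach_origin.
exact: reach_step rx xz.
Qed.

(** A path stopped at its first visit to the sphere of radius [n] only uses vertices of the box;
    without such a visit it never leaves the box. *)
Lemma reach_box w w' n z : (forall x, (linf_norm x <= n)%N -> w x = w' x) ->
  reach w z ->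
  (linf_norm z <= n)%N /\ reach w' z \/ exists2 y, linf_norm y = n & reach w' y.
Proof.
move=> ww'; elim=> [wo|x y _ [[xn rx]|far] xy wy]; last by right.
  left; rewrite linf_origin; split=> //.
  by apply: reach_origin; rewrite -ww'// linf_origin.
move: xn; rewrite leq_eqVlt => /orP[/eqP xn|xn]; first by right; exists x.
have yn : (linf_norm y <= n)%N := leq_trans (linf_adjacent xy) xn.
by left; split=> //; apply: reach_step rx xy _; rewrite -ww'.
Qed.

Definition arm n : set (config d) :=
  [set w | connected_to w (origin d) (sphere d n)].

(** [0 < n] keeps the origin off the sphere, which leaves only the disjunct with a path. *)
Lemma armP n w : (0 < n)%N -> arm n w <-> exists2 y, linf_norm y = n & reach w y.
Proof.
move=> n0; split=> [[|[y yn /reachP]]|[y yn /reachP wy]].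
- by rewrite /sphere/= linf_origin => n0'; rewrite -n0' in n0.
- by exists y.
- by right; exists y.
Qed.

Lemma arm_increasing n : (0 < n)%N -> increasing_event (arm n).
Proof.
move=> n0 w w' ww' /(armP _ n0)[y yn wy]; apply/(armP _ n0); exists y => //.
exact: reach_mono wy.
Qed.

Lemma arm_determined n : (0 < n)%N -> determined_by [set` box d n] (arm n).
Proof.
move=> n0 w w' ww' /(armP _ n0)[y yn wy]; apply/(armP _ n0).
have {}ww' x : (linf_norm x <= n)%N -> w x = w' x.
  by move=> xn; apply: ww'; rewrite /= mem_box.
by have [[_]|//] := reach_box ww' wy; exists y.
Qed.

Lemma arm_nonincreasing m n : (0 < m)%N -> (m <= n)%N -> arm n `<=` arm m.
Proof.
move=> m0 mn w /(armP _ (leq_trans m0 mn))[y yn wy]; apply/(armP _ m0).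
have [[ym _]|//] := reach_box (fun x (_ : (linf_norm x <= m)%N) => erefl (w x)) wy.
by exists y => //; apply/eqP; rewrite eqn_leq ym yn.
Qed.

(** A cluster that misses some sphere is confined to a box, hence finite; a finite cluster has
    bounded norm, hence misses a larger sphere. *)
Lemma infinite_clusterE :
  [set w | infinite_set (cluster w (origin d))] = \bigcap_n arm n.+1.
Proof.
apply/seteqP; split=> w /=.
  move=> winf n _; apply/(armP _ (ltn0Sn n)); apply: contrapT => noarm.
  apply: winf; apply: sub_finite_set (finite_box d n.+1) => y /= /reachP wy.
  by have [[]|] := reach_box (fun x (_ : (linf_norm x <= n.+1)%N) => erefl (w x)) wy.
move=> warm wfin.
have [s sE] : exists s : seq (vertex d), forall y, cluster w (origin d) y -> y \in s.
  exists (fset_set (cluster w (origin d))) => y wy.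
  by rewrite in_fset_set// inE.
have /(armP _ (ltn0Sn _))[y yn /reachP wy] := warm (\max_(x <- s) linf_norm x) I.
have := @leq_bigmax_seq _ s xpredT (@linf_norm d) y (sE y wy) isT.
by rewrite yn ltnn.
Qed.

(* A path through [e] enters and leaves it by the same endpoint, and for [n]
   even it may stop at that endpoint instead of stopping at [e]. *)
Lemma bond_useless n w e x : (0 < n)%N -> ~~ odd n -> ~~ is_site e -> adjacent e x ->
  w x = false -> arm n (set_at w e true) -> arm n (set_at w e false).
Proof.
move=> n0 n2 be ex wx /(armP _ n0)[y yn wy]; apply/(armP _ n0).
have oe : origin d != e by apply: contraNneq be => <-; exact: origin_site.
have wxb b : set_at w e b x = false by rewrite set_at_neq// eq_sym adjacent_neq.
(* Invariant along the path: whatever is reached with [e] occupied is reached with [e] empty, except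
   [e] itself, for which a neighbour is reached instead. *)
suff [ye|[z [ez ye wz]]] : reach (set_at w e false) y \/
    (exists z, [/\ adjacent e z, y = e & reach (set_at w e false) z]).
  by exists y.
  exists z => //; rewrite ye in yn; rewrite -yn; apply: linf_bond_endpoint => //.
  by rewrite yn.
elim: wy {yn} => [wo|a z wa IH az wz].
  by left; apply: reach_origin; move: wo; rewrite !set_at_neq.
case: IH => [ra|[b [eb ae rb]]].
  have [ze|ze] := eqVneq z e; first by right; exists a; split=> //; rewrite -ze adjacent_sym.
  by left; apply: reach_step ra az _; move: wz; rewrite !set_at_neq.
left; have bx : b != x.
  by apply/eqP => bx; have := reach_occupied rb; rewrite bx wxb.
have zx : z != x by apply/eqP => zx; rewrite zx wxb in wz.
rewrite ae in az.
by rewrite -(bond_neighbour_unique be ex eb az bx zx).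
Qed.

(** With all its neighbours empty, [x] can lie on an occupied path from the origin only if it is the
    origin, and then the path stops there, short of the sphere. *)
Lemma isolated_useless n w x : (0 < n)%N ->
  {in neighbours x, forall y, w y = false} ->
  arm n (set_at w x true) -> arm n (set_at w x false).
Proof.
move=> n0 wN /(armP _ n0)[y yn wy]; apply/(armP _ n0).
have {}wN z b : adjacent x z -> set_at w x b z = false.
  by move=> xz; rewrite set_at_neq ?wN ?mem_neighbours// eq_sym adjacent_neq.
suff [[_ y0]|wy0] : (y = x /\ y = origin d) \/ reach (set_at w x false) y.
- by move: n0; rewrite -yn y0 linf_origin.
- by exists y.
elim: wy {yn} => [wo|a z wa IH az wz].
  have [ox|ox] := eqVneq (origin d) x; first by left.
  by right; apply: reach_origin; move: wo; rewrite !set_at_neq.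
case: IH => [[ax _]|ra]; first by rewrite ax in az; rewrite (wN _ _ az) in wz.
have [zx|zx] := eqVneq z x.
  have xa : adjacent x a by rewrite adjacent_sym -zx.
  by have := reach_occupied ra; rewrite (wN _ _ xa).
by right; apply: reach_step ra az _; move: wz; rewrite !set_at_neq.
Qed.

(** Walks with [n] steps from the origin, stored backwards: the head of each list is the current end
    of the walk. *)
Fixpoint walks n : seq (seq (vertex d)) :=
  if n is m.+1 then
    [seq y :: g | g <- walks m, y <- neighbours (head (origin d) g)]
  else [:: [:: origin d]].

Lemma size_walks n : (size (walks n) <= (2 * d) ^ n)%N.
Proof.
elim: n => [//|n IH] /=; rewrite size_allpairs_dep.
apply: (@leq_trans (size (walks n) * (2 * d))).
  elim: {IH} (walks n) => //= g s IH; rewrite mulSn leq_add//.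
  exact: size_neighbours.
by rewrite expnSr leq_mul2r IH orbT.
Qed.

Lemma path_walks s : path (@adjacent d) (origin d) s -> rev (origin d :: s) \in walks (size s).
Proof.
elim/last_ind: s => [|s y IH]; first by rewrite /= mem_head.
rewrite rcons_path => /andP[/IH gs sy]; rewrite size_rcons -rcons_cons rev_rcons/=.
apply: allpairs_f_dep => //; rewrite mem_neighbours.
suff -> : head (origin d) (rev (origin d :: s)) = last (origin d) s by [].
by rewrite (lastI (origin d) s) rev_rcons.
Qed.

Lemma linf_path x s : path (@adjacent d) x s -> (linf_norm (last x s) <= linf_norm x + size s)%N.
Proof.
elim: s x => [x _|y s IH x]/=; first by rewrite addn0.
move=> /andP[/linf_adjacent xy /IH ys]; rewrite addnS -addSn.
by rewrite (leq_trans ys)// leq_add2r.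
Qed.

(** The norm grows by at most one per step, so a self-avoiding shortening of the path has at least
    [n] steps; its first [n] steps are kept. *)
Lemma arm_walk n w : (0 < n)%N -> arm n w ->
  exists g, [/\ g \in walks n, uniq g & all w g].
Proof.
move=> n0 /(armP _ n0)[y yn /reachP[s [ps ws sy]]].
move: sy; have [s' ps' us' ss'] := shortenP ps; move=> sy.
have ns' : (n <= size s')%N.
  by have := linf_path ps'; rewrite linf_origin sy yn.
exists (rev (origin d :: take n s')); split.
- rewrite -[n in walks n](size_takel ns'); apply: path_walks.
  by have := ps'; rewrite -[s' in X in X -> _](cat_take_drop n) cat_path => /andP[].
- rewrite rev_uniq; have := us'; rewrite -[s' in X in X -> _](cat_take_drop n) -cat_cons.
  by rewrite cat_uniq => /andP[].
- rewrite all_rev; apply/allP => z zs.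
  have /allP := ws; apply; move: zs; rewrite !inE => /orP[->//|zs].
  by rewrite ss' ?orbT// (mem_take zs).
Qed.
End connectivity.

(** * Couplings *)

Section percolation_probabilities.
Variables (R : realType) (d : nat).
Variable Pr : R -> R -> probability (config_space d) R.
Hypothesis Pr_law : site_bond_percolation Pr.
Implicit Types (p q c : R) (x y z : vertex d).

Definition rates p q : vertex d -> R := fun x => if is_site x then q else p.

Definition empty_config : config d := fun=> false.

Lemma rates01 p q : 0 <= p <= 1 -> 0 <= q <= 1 -> forall x, 0 <= rates p q x <= 1.
Proof. by move=> p01 q01 x; rewrite /rates; case: ifP. Qed.

Lemma box_event_prob p q n A : 0 <= p <= 1 -> 0 <= q <= 1 ->
  determined_by [set` box d n] A ->
  measurable (A : set (config_space d)) /\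
  Pr p q A = (bern (box d n) (rates p q) A empty_config)%:E.
Proof.
move=> p01 q01 An; have [Pm Pi] := Pr_law p01 q01.
by apply: determined_event_prob => //; exact: box_uniq.
Qed.

Lemma measurable_arm n : (0 < n)%N -> measurable (arm n : set (config_space d)).
Proof.
move=> n0; have i01 : 0 <= (0 : R) <= 1 by rewrite lexx ler01.
exact: (box_event_prob i01 i01 (arm_determined n0)).1.
Qed.

Lemma theta_nE n p q : (0 < n)%N -> 0 <= p <= 1 -> 0 <= q <= 1 ->
  theta_n Pr n p q = bern (box d n) (rates p q) (arm n) empty_config.
Proof.
move=> n0 p01 q01; rewrite /theta_n.
by have [_ /= ->] := box_event_prob p01 q01 (arm_determined n0).
Qed.

Lemma measurable_infinite_cluster :
  measurable ([set w | infinite_set (cluster w (origin d))] : set (config_space d)).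
Proof.
rewrite infinite_clusterE; apply: bigcap_measurable => // n _.
exact: measurable_arm.
Qed.

Lemma theta_ge0 p q : 0 <= theta Pr p q.
Proof. exact: fine_ge0. Qed.

Lemma theta_le_theta_n n p q : (0 < n)%N -> theta Pr p q <= theta_n Pr n p q.
Proof.
move=> n0; have mI := measurable_infinite_cluster; have mA := measurable_arm n0.
rewrite /theta /theta_n fine_le ?fin_num_measure//.
rewrite le_measure ?inE//; rewrite infinite_clusterE; case: n n0 {mA} => // n _ w.
exact.
Qed.

(** Continuity from above along the decreasing arm events. Even radii suffice by monotonicity in the
    radius, and [bond_useless] is stated for those. *)
Lemma le_theta p q c :
  (forall k, c <= theta_n Pr k.+1.*2 p q) -> c <= theta Pr p q.
Proof.
move=> cn; have mI := measurable_infinite_cluster.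
rewrite -lee_fin fineK ?fin_num_measure//.
have cvgP : Pr p q (arm n.+1) @[n --> \oo] --> Pr p q (\bigcap_n arm n.+1).
  apply: nonincreasing_cvg_mu => //.
  - by rewrite -ge0_fin_numE// fin_num_measure//; exact: measurable_arm.
  - by move=> i; exact: measurable_arm.
  - by rewrite -infinite_clusterE.
  - by apply/nonincreasing_seqP => n; apply/subsetPset; exact: arm_nonincreasing.
rewrite infinite_clusterE -(cvg_lim _ cvgP)//; apply: lime_ge.
  by apply/cvg_ex; eexists; exact: cvgP.
near=> n; rewrite -(fineK (fin_num_measure _ _ (measurable_arm (ltn0Sn n)))) lee_fin.
apply: (le_trans (cn n)); rewrite /theta_n fine_le ?fin_num_measure//; try exact: measurable_arm.
rewrite le_measure ?inE//; try exact: measurable_arm.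
by apply: arm_nonincreasing => //; rewrite doubleS -addnn; lia.
Unshelve. all: by end_near. Qed.

Lemma theta_comparison p q p' q' : 0 <= p <= 1 -> 0 <= q <= 1 ->
    0 <= p' <= 1 -> 0 <= q' <= 1 ->
  (forall n, (0 < n)%N -> ~~ odd n ->
    bern (box d n) (rates p q) (arm n) empty_config <=
    bern (box d n) (rates p' q') (arm n) empty_config) ->
  theta Pr p q <= theta Pr p' q'.
Proof.
move=> p01 q01 p'01 q'01 h; apply: le_theta => k.
have k0 : (0 < k.+1.*2)%N by rewrite doubleS.
apply: (le_trans (theta_le_theta_n p q k0)).
by rewrite !theta_nE// h// odd_double.
Qed.

Lemma le_rates p q p' q' : 0 <= p -> p <= p' -> p' <= 1 -> 0 <= q -> q <= q' -> q' <= 1 ->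
  forall x, [/\ 0 <= rates p q x, rates p q x <= rates p' q' x & rates p' q' x <= 1].
Proof. by move=> *; rewrite /rates; case: ifP; split. Qed.

Lemma le_theta_n n p q p' q' : (0 < n)%N -> 0 <= p -> p <= p' -> p' <= 1 ->
  0 <= q -> q <= q' -> q' <= 1 -> theta_n Pr n p q <= theta_n Pr n p' q'.
Proof.
move=> n0 p0 pp' p'1 q0 qq' q'1; rewrite !theta_nE//; last 4 first.
- by rewrite (le_trans p0 pp').
- by rewrite (le_trans q0 qq').
- by rewrite p0 (le_trans pp').
- by rewrite q0 (le_trans qq').
apply: bern_mono; first exact: arm_increasing.
by move=> x _; exact: le_rates.
Qed.

Lemma theta_mono p q p' q' : 0 <= p -> p <= p' -> p' <= 1 ->
  0 <= q -> q <= q' -> q' <= 1 -> theta Pr p q <= theta Pr p' q'.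
Proof.
move=> p0 pp' p'1 q0 qq' q'1; apply: le_theta => k.
apply: (le_trans (theta_le_theta_n p q (ltn0Sn k.*2.+1))).
by apply: le_theta_n => //; rewrite doubleS.
Qed.

(** By [bern_thin_endpoint], thinning a bond by [c] is no worse than thinning its chosen endpoint;
    the bonds of the box are treated one at a time. *)
Lemma theta_thin_bonds p q c : 0 <= p <= 1 -> 0 <= q <= 1 -> 0 <= c <= 1 ->
  theta Pr p (q * c ^+ (2 * d)) <= theta Pr (p * c) q.
Proof.
move=> p01 q01 c01; have /andP[p0 p1] := p01; have /andP[q0 q1] := q01.
have /andP[c0 c1] := c01.
have ck k : 0 <= c ^+ k <= 1 by rewrite exprn_ge0 ?exprn_ile1.
have m01 a b : 0 <= a <= 1 -> 0 <= b <= 1 -> 0 <= a * b <= 1.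
  by move=> /andP[? ?] /andP[? ?]; rewrite mulr_ge0//= mulr_ile1.
apply: theta_comparison => //; try exact: m01.
move=> n n0 n2; set B := box d n.
(* In [rho L] the bonds of [L] are not thinned yet; each of them is paid for by
   a factor [c] at its endpoint. *)
pose rho L y := if is_site y then q * c ^+ (count (fun e => endpoint e == y) L)
                else if y \in L then p else p * c.
have rho01 L y : 0 <= rho L y <= 1.
  by rewrite /rho; case: ifP => _; [exact: m01|case: ifP => // _; exact: m01].
have step L : uniq L -> {in L, forall e, ~~ is_site e} ->
    bern B (rho L) (arm n) empty_config <= bern B (rates (p * c) q) (arm n) empty_config.
  elim: L => [_ _|e L IH /= /andP[eL uL] bL].
    rewrite (_ : rho [::] = rates (p * c) q)//.
    by apply/funext => y; rewrite /rho /rates/= mulr1.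
  have be : ~~ is_site e by apply: bL; rewrite mem_head.
  have bL' : {in L, forall e, ~~ is_site e} by move=> y yL; apply: bL; rewrite inE yL orbT.
  apply: le_trans (IH uL bL').
  pose r y := if is_site y then q * c ^+ (count (fun e => endpoint e == y) L)
                else if y \in e :: L then p else p * c.
  have se : is_site (endpoint e) by rewrite (adjacent_site (endpointP be)) be.
  have -> : rho (e :: L) = set_at r (endpoint e) (c * r (endpoint e)).
    apply/funext => y; rewrite /set_at /rho /r/= se.
    case: (eqVneq y (endpoint e)) => [->|ye]; first by rewrite se add1n exprS mulrCA.
    by rewrite add0n.
  have -> : rho L = set_at r e (c * r e).
    apply/funext => y; rewrite /set_at /rho /r (negbTE be) mem_head.
    rewrite inE; case: eqVneq => [->|//].
    by rewrite (negbTE be) (negbTE eL) mulrC.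
  have r01 y : 0 <= r y <= 1.
    by rewrite /r; case: ifP => _; [exact: m01|case: ifP => // _; exact: m01].
  apply: bern_thin_endpoint => //; first exact: box_uniq.
  - exact: arm_increasing.
  - exact/adjacent_neq/endpointP.
  - by move=> w'; apply: bond_useless => //; exact: endpointP.
(* All bonds of the box are charged to their endpoints: a site receives at most [2 * d] factors, so
   its parameter is at least [q * c ^+ (2 * d)]. *)
apply: le_trans (step [seq e <- B | ~~ is_site e] _ _); last 2 first.
- exact/filter_uniq/box_uniq.
- by move=> e; rewrite mem_filter => /andP[].
apply: bern_mono; first exact: arm_increasing.
move=> y yB; have /andP[_ rho1] := rho01 [seq e <- B | ~~ is_site e] y.
split=> //; first by case/andP: (rates01 p01 (m01 _ _ _ q01 (ck (2 * d)%N)) y).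
rewrite /rates /rho; case: ifP => ys; last by rewrite mem_filter ys yB.
rewrite ler_wpM2l// ler_wiXn2l//.
apply: leq_trans (size_neighbours y); rewrite -size_filter.
apply: uniq_leq_size; first by rewrite !filter_uniq// box_uniq.
move=> e; rewrite mem_neighbours !mem_filter => /andP[/eqP <- /andP[be _]].
by rewrite adjacent_sym endpointP.
Qed.

(** By [bern_thin_neighbours], thinning the bonds around an occupied site is at least as harmful as
    emptying the site with the probability that the thinning erases them all; the sites of the box
    are treated one at a time. *)
Lemma theta_thin_sites p c : 0 <= p <= 1 -> 0 <= c <= 1 ->
  theta Pr (p * c ^+ (2 * d)) 1 <= theta Pr p (1 - (1 - c) ^+ (2 * d)).
Proof.
move=> p01 c01; have /andP[p0 p1] := p01; have /andP[c0 c1] := c01.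
have ck k : 0 <= c ^+ k <= 1 by rewrite exprn_ge0 ?exprn_ile1.
have c'k k : 0 <= (1 - c) ^+ k <= 1 by rewrite exprn_ge0 ?exprn_ile1//; lra.
have m01 a b : 0 <= a <= 1 -> 0 <= b <= 1 -> 0 <= a * b <= 1.
  by move=> /andP[? ?] /andP[? ?]; rewrite mulr_ge0//= mulr_ile1.
have i01 : 0 <= (1 : R) <= 1 by rewrite lexx ler01.
have Q01 : 0 <= 1 - (1 - c) ^+ (2 * d) <= 1 by have := c'k (2 * d)%N; lra.
apply: theta_comparison => //; first exact: m01.
move=> n n0 _; set B := box d n; set Q := 1 - (1 - c) ^+ (2 * d) in Q01 *.
(* In [sig L] the sites of [L] are not thinned yet; each of them is paid for by
   a factor [c] at the adjacent bonds. *)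
pose sig L y := if is_site y then (if y \in L then 1 else Q)
                else p * c ^+ (count (fun x => y \in neighbours x) L).
have sig01 L y : 0 <= sig L y <= 1.
  by rewrite /sig; case: ifP => _; [case: ifP|exact: m01].
have step L : uniq L -> {in L, forall x, is_site x} ->
    bern B (sig L) (arm n) empty_config <= bern B (rates p Q) (arm n) empty_config.
  elim: L => [_ _|x L IH /= /andP[xL uL] sL].
    rewrite (_ : sig [::] = rates p Q)//.
    by apply/funext => y; rewrite /sig /rates/= mulr1.
  have sx : is_site x by apply: sL; rewrite mem_head.
  have sL' : {in L, forall e, is_site e} by move=> y yL; apply: sL; rewrite inE yL orbT.
  apply: le_trans (IH uL sL').
  pose r y := if is_site y then (if y \in x :: L then 1 else Q)
                else p * c ^+ (count (fun x => y \in neighbours x) L).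
  have r01 y : 0 <= r y <= 1.
    by rewrite /r; case: ifP => _; [case: ifP|exact: m01].
  have -> : sig (x :: L) = thin_at (neighbours x) c r.
    apply/funext => y; rewrite /thin_at /sig /r/= mem_neighbours.
    case: (boolP (adjacent x y)) => [xy|_].
      by rewrite (adjacent_site xy) sx/= add1n exprS mulrCA.
    by rewrite add0n.
  have rx : r x = 1 by rewrite /r sx mem_head.
  apply: (@le_trans _ _ (bern B (set_at r x (1 - (1 - c) ^+ size (neighbours x)))
     (arm n) empty_config)).
    apply: bern_thin_neighbours => //; [exact: box_uniq|exact: neighbours_uniq| | |].
    - by rewrite mem_neighbours; apply/negP => /adjacent_neq; rewrite eqxx.
    - exact: arm_increasing.
    - by move=> w'; exact: isolated_useless.
  apply: bern_mono; first exact: arm_increasing.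
  move=> y yB; have /andP[sig0 sig1] := sig01 L y; split=> //.
    rewrite /set_at; case: eqP => _; last by case/andP: (r01 y).
    by rewrite subr_ge0; case/andP: (c'k (size (neighbours x))).
  rewrite /set_at /sig /r; case: eqVneq => [->|yx].
    rewrite sx (negbTE xL) lerB// ler_wiXn2l ?size_neighbours// ?subr_ge0//.
    by rewrite gerBl.
  by rewrite inE (negbTE yx).
(* A bond is thinned once per endpoint in the box, which is at most [2 * d] times by the general
   bound on the degree. *)
apply: le_trans (step [seq x <- B | is_site x] _ _); last 2 first.
- exact/filter_uniq/box_uniq.
- by move=> e; rewrite mem_filter => /andP[].
apply: bern_mono; first exact: arm_increasing.
move=> y yB; have /andP[_ rho1] := sig01 [seq e <- B | is_site e] y.
split=> //; first by case/andP: (rates01 (m01 _ _ _ p01 (ck (2 * d)%N)) i01 y).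
rewrite /rates /sig; case: ifP => ys; first by rewrite mem_filter ys yB.
rewrite ler_wpM2l// ler_wiXn2l//.
apply: leq_trans (size_neighbours y); rewrite -size_filter.
apply: uniq_leq_size; first by rewrite !filter_uniq// box_uniq.
move=> x; rewrite mem_filter => /andP[xy _]; move: xy.
by rewrite !mem_neighbours adjacent_sym.
Qed.

End percolation_probabilities.

(** * Counting walks, and percolation at full parameters *)

Section extreme_parameters.
Variables (R : realType) (d : nat).
Variable Pr : R -> R -> probability (config_space d) R.
Hypothesis Pr_law : site_bond_percolation Pr.

Lemma all_occupied_prob (p q : R) (g : seq (vertex d)) : 0 <= p <= 1 -> 0 <= q <= 1 -> uniq g ->
  measurable ([set w : config d | all w g] : set (config_space d)) /\
  Pr p q [set w : config d | all w g] = (\prod_(x <- g) rates p q x)%:E.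
Proof.
move=> p01 q01 ug; have [Pm Pi] := Pr_law p01 q01.
have gE : [fset x in g]%fset =i g by move=> x; rewrite inE.
have -> : [set w : config d | all w g] = cylinder [fset x in g]%fset (fun=> true).
  apply/seteqP; split=> w /=.
    by move=> /allP wg x; rewrite gE => /wg.
  by move=> wg; apply/allP => x xg; rewrite wg// gE.
have [mC ->] := cylinder_prob [fset x in g]%fset (fun=> true) Pm Pi.
split=> //; congr (_%:E); apply: perm_big.
by apply: uniq_perm.
Qed.

(** Union bound over [L]. Lists with repetitions are discarded because the product formula is that
    of distinct vertices. *)
Lemma some_occupied_prob (p q : R) (L : seq (seq (vertex d))) (b : R) :
  0 <= p <= 1 -> 0 <= q <= 1 ->
  {in L, forall g, \prod_(x <- g) rates p q x <= b} -> 0 <= b ->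
  measurable ([set w : config d | exists g, [/\ g \in L, uniq g & all w g]] :
    set (config_space d)) /\
  (Pr p q [set w : config d | exists g, [/\ g \in L, uniq g & all w g]] <= ((size L)%:R * b)%:E)%E.
Proof.
move=> p01 q01 + b0; elim: L => [_|g L IH Lb].
  rewrite (_ : [set w | _] = set0) ?measure0 ?mul0r; first by split.
  by apply/seteqP; split=> w // -[g []].
have [|mL PL] := IH _; first by move=> h hL; apply: Lb; rewrite inE hL orbT.
have [ug|ug] := boolP (uniq g).
  have [mg Pg] := all_occupied_prob p01 q01 ug.
  have Pgb : (Pr p q [set w : config d | all w g] <= b%:E)%E.
    by rewrite Pg lee_fin Lb ?mem_head.
  rewrite (_ : [set w | _] = [set w : config d | all w g] `|`
      [set w : config d | exists g, [/\ g \in L, uniq g & all w g]]).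
    split; first exact: measurableU.
    apply: le_trans (measureU2 _ mg mL) _.
    rewrite [(size _)%:R]mulrS mulrDl mul1r EFinD; apply: leeD => //.
  apply/seteqP; split=> w /=.
    move=> [h []]; rewrite inE => /orP[/eqP ->|hL] uh wh; [by left|right].
    by exists h.
  move=> [wg|[h [hL uh wh]]]; first by exists g; rewrite mem_head.
  by exists h; rewrite inE hL orbT.
rewrite (_ : [set w | _] = [set w : config d | exists g, [/\ g \in L, uniq g & all w g]]).
  by split=> //; apply: (le_trans PL); rewrite lee_fin ler_wpM2r// ler_nat leqnSn.
apply/seteqP; split=> w /= -[h [hL uh wh]]; exists h; split=> //.
  by move: hL; rewrite inE => /orP[/eqP hg|//]; rewrite -hg uh in ug.
by rewrite inE hL orbT.
Qed.

(** Sites and bonds alternate along a walk that starts at a site, so [n] steps visit [uphalf n]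
    bonds, counted with multiplicity; sites contribute the factor 1. *)
Lemma walks_rates (p : R) n g : g \in walks d n ->
  is_site (head (origin d) g) = ~~ odd n /\
  \prod_(x <- g) rates p 1 x = p ^+ (uphalf n).
Proof.
elim: n g => [|n IH] g /=.
  rewrite inE => /eqP ->; by rewrite big_seq1 /rates origin_site/= expr0.
move=> /allpairsPdep[h [y [hn]]]; have [hs hp] := IH h hn.
rewrite mem_neighbours => hy ->; have ys := adjacent_site hy.
rewrite /= big_cons hp ys hs negbK; split=> //.
rewrite /rates ys hs negbK uphalf_half; case: (odd n) => /=.
  by rewrite mul1r add1n.
by rewrite add0n -exprS.
Qed.

(** There are at most [(2d)^(2k)] walks of [2k] steps, each occupied with probability [p^k] when
    self-avoiding; the value of [p] makes the product [2^(-k)]. *)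
Lemma theta_small (p : R) : (0 < d)%N -> p = (2 * (2 * d)%:R ^+ 2)^-1 -> theta Pr p 1 = 0.
Proof.
move=> d0 pE; set D : R := (2 * d)%:R.
have D1 : 1 <= D by rewrite ler1n; lia.
have p0 : 0 < p by rewrite pE invr_gt0 mulr_gt0// exprn_gt0// (lt_le_trans ltr01).
have p1 : p <= 1.
  rewrite pE invf_le1 ?mulr_gt0// ?exprn_gt0// ?(lt_le_trans ltr01)//.
  by rewrite -[leLHS]mulr1 ler_pM// ?ler1n// exprn_ege1.
have p01 : 0 <= p <= 1 by rewrite ltW.
have i01 : 0 <= (1 : R) <= 1 by rewrite lexx ler01.
have bound k : theta Pr p 1 <= 2^-1 ^+ k.+1.
  have k0 : (0 < k.+1.*2)%N by [].
  apply: (le_trans (theta_le_theta_n Pr_law p 1 k0)).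
  have [|mW PW] := @some_occupied_prob p 1 (walks d k.+1.*2) (p ^+ k.+1) p01 i01 _
    (exprn_ge0 _ (ltW p0)).
    by move=> g /(walks_rates p)[_ ->]; rewrite uphalf_double.
  have mA := measurable_arm Pr_law k0.
  rewrite -lee_fin /theta_n fineK ?fin_num_measure//.
  apply: (@le_trans _ _ (Pr p 1 [set w : config d |
      exists g, [/\ g \in walks d k.+1.*2, uniq g & all w g]])).
    rewrite le_measure ?inE//.
    by move=> w; exact: arm_walk.
  apply: (le_trans PW); rewrite lee_fin.
  apply: (@le_trans _ _ (D ^+ k.+1.*2 * p ^+ k.+1)).
    by rewrite ler_wpM2r ?exprn_ge0 ?(ltW p0)// /D -natrX ler_nat size_walks.
  rewrite -mul2n exprM -exprMn pE -/D invfM mulrCA divff ?mulr1//.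
  by rewrite expf_eq0/= gt_eqF// (lt_le_trans ltr01).
apply/eqP; rewrite eq_le theta_ge0 andbT.
have cv : (2^-1 : R) ^+ k @[k --> \oo] --> (0 : R).
  by apply: cvg_expr; rewrite gtr0_norm ?invr_gt0// invf_lt1// ltr1n.
apply: (ler_cvg_to (@cvg_cst _ (theta Pr p 1) _ _ _) (cv)).
have bound' k : (0 < k)%N -> theta Pr p 1 <= 2^-1 ^+ k by case: k.
by near=> k; apply: bound'; near: k; exact: nbhs_infty_gt.
Unshelve. all: by end_near. Qed.

Lemma arm_full n : (0 < d)%N -> (0 < n)%N -> @arm d n (fun=> true).
Proof.
move=> d0 n0; pose k : 'I_d := Ordinal d0.
pose v (j : nat) : 'rV[int]_d := \row_i (if i == k then j%:Z else 0).
have vE j i : v j ord0 i = if i == k then j%:Z else 0 by rewrite mxE.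
have vP j : at_most_one_odd (v j).
  rewrite /at_most_one_odd -[leqRHS](card1 k); apply: subset_leq_card.
  apply/fintype.subsetP => i; rewrite !inE vE.
  by case: eqP.
pose a j : vertex d := exist _ (v j) (vP j).
have aE j i : coord (a j) i = if i == k then j%:Z else 0 by rewrite -vE.
apply/(armP _ n0); exists (a n).
  apply/eqP; rewrite eqn_leq; apply/andP; split.
    by apply/linf_leP => i; rewrite aE; case: eqP.
  by have := leq_linf (a n) k; rewrite aE eqxx.
elim: n {n0} => [|n IH].
  rewrite (_ : a 0%N = origin d); first exact: reach_origin.
  by apply: vertexP => i; rewrite aE /coord/= mxE; case: eqP.
apply: reach_step IH _ isT; apply/sum_nat_eq1; exists k; split=> //.
  by rewrite !aE eqxx; lia.
by move=> j jk _; rewrite !aE (negbTE jk).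
Qed.

Lemma theta_full : (0 < d)%N -> 0 < theta Pr 1 1.
Proof.
move=> d0; have i01 : 0 <= (1 : R) <= 1 by rewrite lexx ler01.
apply: (@lt_le_trans _ _ 1) => //; apply: le_theta => // k.
rewrite theta_nE// -[leLHS](bern_true (box d k.+1.*2) (rates 1 1) (@empty_config d)).
rewrite (@eq_bern_event _ _ _ _ (fun=> True) (arm k.+1.*2))// => w' [_ w'1 _].
split=> // _; have k0 : (0 < k.+1.*2)%N by [].
apply: arm_determined (arm_full d0 k0) => // x xB.
by rewrite w'1// /rates; case: ifP.
Qed.

End extreme_parameters.

(** * The critical curve *)

Section critical_curve.
Variables (R : realType) (d : nat).
Hypothesis d_gt0 : (0 < d)%N.
Variable Pr : R -> R -> probability (config_space d) R.
Hypothesis Pr_law : site_bond_percolation Pr.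

Let pmin : R := (2 * (2 * d)%:R ^+ 2)^-1.

Lemma pmin01 : 0 < pmin <= 1.
Proof.
have D1 : 1 <= (2 * d)%:R :> R by rewrite ler1n; lia.
have D0 : 0 < (2 * d)%:R :> R by rewrite (lt_le_trans ltr01).
rewrite /pmin invr_gt0 mulr_gt0 ?exprn_gt0//= invf_le1 ?mulr_gt0 ?exprn_gt0//.
by rewrite -[leLHS]mulr1 ler_pM// ?ler1n// exprn_ege1.
Qed.

Lemma theta_pmin : theta Pr pmin 1 = 0.
Proof. exact: theta_small. Qed.

Lemma theta_eq0_mono p q p' q' : 0 <= p -> p <= p' -> p' <= 1 ->
  0 <= q -> q <= q' -> q' <= 1 -> theta Pr p' q' = 0 -> theta Pr p q = 0.
Proof.
move=> p0 pp' p'1 q0 qq' q'1 h; apply/eqP; rewrite eq_le theta_ge0 andbT -h.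
exact: theta_mono.
Qed.

(** [theta_thin_bonds] at [p = q = 1] and [c = pmin] bounds [theta] at [(1, pmin ^+ (2 * d))] by
    [theta] at [(pmin, 1)], which is 0 by path counting. *)
Lemma theta_small_site p : 0 <= p <= 1 -> theta Pr p (pmin ^+ (2 * d)) = 0.
Proof.
move=> /andP[p0 p1]; have /andP[m0 m1] := pmin01.
apply: (@theta_eq0_mono p _ 1 (pmin ^+ (2 * d))) => //.
- by rewrite exprn_ge0// ltW.
- by rewrite exprn_ile1// ltW.
apply/eqP; rewrite eq_le theta_ge0 andbT -theta_pmin -[X in theta Pr X 1]mul1r.
rewrite -[X in theta Pr 1 X]mul1r.
by apply: theta_thin_bonds => //; rewrite ?lexx ?ler01// ltW.
Qed.

Let zeros p := [set q : R | 0 <= q <= 1 /\ theta Pr p q = 0].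

Let zeros_bounded p : has_ubound (zeros p).
Proof. by exists 1 => q [/andP[]]. Qed.

Let zeros_nonempty p : 0 <= p <= 1 -> zeros p !=set0.
Proof.
move=> p01; exists (pmin ^+ (2 * d)); split; last exact: theta_small_site.
by have /andP[m0 m1] := pmin01; rewrite exprn_ge0 ?exprn_ile1// ltW.
Qed.

Lemma theta_eq0_le_qc p q : 0 <= q <= 1 -> theta Pr p q = 0 -> q <= qc Pr p.
Proof. by move=> q01 pq; exact: (ub_le_sup (zeros_bounded p)). Qed.

Lemma qc_gt0 p : 0 <= p <= 1 -> 0 < qc Pr p.
Proof.
move=> p01; have /andP[m0 m1] := pmin01.
apply: (@lt_le_trans _ _ (pmin ^+ (2 * d))); first by rewrite exprn_gt0.
apply: theta_eq0_le_qc; last exact: theta_small_site.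
by rewrite exprn_ge0 ?exprn_ile1// ltW.
Qed.

Lemma qc_le p b : 0 <= p <= 1 ->
  (forall q, 0 <= q <= 1 -> theta Pr p q = 0 -> q <= b) -> qc Pr p <= b.
Proof.
move=> p01 h; apply: ge_sup; first exact: zeros_nonempty.
by move=> q [q01 pq]; exact: h.
Qed.

Lemma qc_le1 p : 0 <= p <= 1 -> qc Pr p <= 1.
Proof. by move=> p01; apply: qc_le => // q /andP[]. Qed.

Lemma theta_lt_qc p q : 0 <= p <= 1 -> 0 <= q -> q < qc Pr p -> theta Pr p q = 0.
Proof.
move=> p01 q0 qp; have /andP[p0 p1] := p01.
have [q' [/andP[q'0 q'1] pq'] qq'] := sup_gt (zeros_nonempty p01) qp.
by apply: (@theta_eq0_mono p _ p q') => //; exact: ltW.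
Qed.

Lemma theta_gt_qc p q : qc Pr p < q -> 0 <= q <= 1 -> 0 < theta Pr p q.
Proof.
move=> pq q01; rewrite lt_neqAle theta_ge0 andbT eq_sym.
by apply: contraTneq pq => /(theta_eq0_le_qc q01); rewrite leNgt.
Qed.

Lemma qc_le_of_theta_gt0 p b : 0 <= p <= 1 -> 0 <= b -> 0 < theta Pr p b -> qc Pr p <= b.
Proof.
move=> p01 b0 pb; apply: qc_le => // q /andP[q0 q1] pq.
rewrite leNgt; apply/negP => bq; have /andP[p0 p1] := p01.
by rewrite (@theta_eq0_mono p b p q) ?ltxx// ltW in pb.
Qed.

Let supercritical := [set p : R | 0 <= p <= 1 /\ 0 < theta Pr p 1].

Let supercritical1 : supercritical 1.
Proof. by split; [rewrite lexx ler01|exact: theta_full]. Qed.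

Let supercritical_bounded : has_lbound supercritical.
Proof. by exists 0 => p [/andP[]]. Qed.

Lemma p0c_le1 : p0c Pr <= 1.
Proof. exact: (ge_inf supercritical_bounded). Qed.

Lemma p0c_gt0 : 0 < p0c Pr.
Proof.
have /andP[m0 m1] := pmin01; apply: (lt_le_trans m0).
apply: lb_le_inf; first by exists 1.
move=> p [/andP[p0 p1] pp]; rewrite leNgt; apply/negP => pm.
by rewrite (@theta_eq0_mono p 1 pmin 1) ?ltxx ?theta_pmin// ltW in pp.
Qed.

Lemma theta_lt_p0c p : 0 <= p -> p < p0c Pr -> theta Pr p 1 = 0.
Proof.
move=> p0 pc; apply/eqP; rewrite eq_le theta_ge0 andbT leNgt; apply/negP => pp.
move: (pc); apply/negP; rewrite -leNgt; apply: (ge_inf supercritical_bounded).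
by split=> //; rewrite p0 ltW// (lt_le_trans pc)// p0c_le1.
Qed.

Lemma theta_gt_p0c p : p0c Pr < p ->
  exists p', [/\ 0 <= p', p' < p, p' <= 1 & 0 < theta Pr p' 1].
Proof.
move=> pc; have [|p' [/andP[p'0 p'1] pp'] p'p] := inf_lt _ pc; first by exists 1.
by exists p'.
Qed.

Lemma qc_nonincreasing p1 p2 : 0 <= p1 -> p1 <= p2 -> p2 <= 1 -> qc Pr p2 <= qc Pr p1.
Proof.
move=> p10 p12 p21; apply: qc_le; first by rewrite p21 (le_trans p10).
move=> q q01 pq; apply: theta_eq0_le_qc => //; have /andP[q0 q1] := q01.
exact: (@theta_eq0_mono p1 q p2 q).
Qed.

(** By [theta_thin_bonds], a zero [q] of [theta] at [p * c] yields the zero [q * c ^+ (2 * d)] at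
    [p]. *)
Lemma qc_thin p c : 0 <= p <= 1 -> 0 < c <= 1 -> qc Pr (p * c) * c ^+ (2 * d) <= qc Pr p.
Proof.
move=> /andP[p0 p1] /andP[c0 c1]; have ck : 0 < c ^+ (2 * d) by rewrite exprn_gt0.
rewrite -ler_pdivlMr//; apply: qc_le.
  by rewrite mulr_ge0 ?mulr_ile1// ltW.
move=> q /andP[q0 q1] pq; rewrite ler_pdivlMr//; apply: theta_eq0_le_qc.
  by rewrite mulr_ge0 ?mulr_ile1 ?exprn_ile1// ltW.
apply/eqP; rewrite eq_le theta_ge0 andbT -pq.
by apply: theta_thin_bonds => //; rewrite ?p0 ?q0// ltW.
Qed.

Lemma bernoulli_ineq (c : R) n : 0 <= c <= 1 -> 1 - n%:R * (1 - c) <= c ^+ n.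
Proof.
move=> /andP[c0 c1]; elim: n => [|n IH]; first by rewrite mul0r subr0.
have cn : c ^+ n <= 1 by rewrite exprn_ile1.
rewrite exprS -natr1; nra.
Qed.

(** Combines [qc_thin] for [c = p1 / p2], the Bernoulli inequality for [c ^+ (2 * d)], and the bound
    of [qc] by 1. *)
Lemma qc_increment p1 p2 : 0 < p1 -> p1 <= p2 -> p2 <= 1 ->
  qc Pr p1 - qc Pr p2 <= (2 * d)%:R / p2 * (p2 - p1).
Proof.
move=> p10 p12 p21; have p20 : 0 < p2 := lt_le_trans p10 p12.
have c01 : 0 < p1 / p2 <= 1 by rewrite divr_gt0//= ler_pdivrMr// mul1r.
have p2_01 : 0 <= p2 <= 1 by rewrite ltW.
have := qc_thin p2_01 c01; rewrite [p2 * _]mulrC divfK ?gt_eqF// => h.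
have b := bernoulli_ineq (2 * d) (_ : 0 <= p1 / p2 <= 1).
have {b} := b; rewrite [0 <= _]ltW//=; last by case/andP: c01.
case/andP: c01 => _ -> /(_ isT) b.
have q0 : 0 < qc Pr p1 by rewrite qc_gt0// ltW//= (le_trans p12).
have q1 : qc Pr p1 <= 1 by rewrite qc_le1// ltW//= (le_trans p12).
have -> : (2 * d)%:R / p2 * (p2 - p1) = (2 * d)%:R * (1 - p1 / p2).
  by rewrite -mulrA; congr (_ * _); rewrite mulrBr mulVf ?gt_eqF// mulrC.
have c1 : 0 <= (2 * d)%:R * (1 - p1 / p2).
  by rewrite mulr_ge0// subr_ge0 ler_pdivrMr// mul1r.
move: h b c1; set a := (2 * d)%:R * _; set t := _ ^+ _; nra.
Qed.

(** Below [p0c] even [q = 1] does not percolate, so [qc] is 1 there; [qc_thin] carries this to [p0c]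
    with a loss as small as wanted. *)
Lemma qc_p0c : qc Pr (p0c Pr) = 1.
Proof.
have c0 := p0c_gt0; have c1 := p0c_le1; have c01 : 0 <= p0c Pr <= 1 by rewrite ltW.
apply/eqP; rewrite eq_le qc_le1//= leNgt; apply/negP => q1.
have q0 := qc_gt0 c01.
have D1 : 1 <= (2 * d)%:R :> R by rewrite ler1n; lia.
(* Chosen so that the loss [(2 * d)%:R * t] is half of the supposed gap [1 - qc Pr (p0c Pr)]. *)
pose t : R := (1 - qc Pr (p0c Pr)) / (2 * (2 * d)%:R).
have tE : (2 * d)%:R * t = (1 - qc Pr (p0c Pr)) / 2 by rewrite /t; field; lra.
have t0 : 0 < t by rewrite /t divr_gt0//; lra.
have t1 : t < 1 by nra.
have t01 : 0 < 1 - t <= 1 by lra.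
have := qc_thin c01 t01; rewrite (_ : qc Pr (p0c Pr * (1 - t)) = 1); last first.
  have pt : p0c Pr * (1 - t) < p0c Pr by rewrite gtr_pMr// ltrBlDr ltrDl.
  have pt0 : 0 <= p0c Pr * (1 - t) by rewrite mulr_ge0 ?ltW//; lra.
  apply/eqP; rewrite eq_le qc_le1 ?pt0/=; last by rewrite ltW// (lt_le_trans pt).
  by rewrite theta_eq0_le_qc ?lexx ?ler01//; exact: theta_lt_p0c.
have := @bernoulli_ineq (1 - t) (2 * d); rewrite subKr tE => /(_ _)b.
have {}b : 1 - (1 - qc Pr (p0c Pr)) / 2 <= (1 - t) ^+ (2 * d) by apply: b; lra.
rewrite mul1r => /(le_trans b); lra.
Qed.

(** [theta_thin_sites] trades the excess of [p] over a supercritical [p'] for a site parameter below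
    1. *)
Lemma qc_lt1 p : p0c Pr < p -> p <= 1 -> qc Pr p < 1.
Proof.
move=> pc p1; have [p' [p'0 p'p p'1 pp']] := theta_gt_p0c pc.
have p0 : 0 < p by apply: lt_trans p0c_gt0 pc.
have p01 : 0 <= p <= 1 by rewrite ltW.
have D2 : 2 <= (2 * d)%:R :> R by rewrite ler_nat; lia.
(* With [c = 1 - t], the Bernoulli inequality gives [p' <= p * c ^+ (2 * d)], and the resulting site
   parameter is [1 - t ^+ (2 * d)]. *)
pose t : R := (1 - p' / p) / (2 * d)%:R.
have p'p0 : 0 <= p' / p by rewrite divr_ge0// ltW.
have p'p1 : p' / p < 1 by rewrite ltr_pdivrMr// mul1r.
have tE : (2 * d)%:R * t = 1 - p' / p by rewrite /t mulrC divfK//; lra.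
have t0 : 0 < t by rewrite /t divr_gt0//; lra.
have t1 : t < 1 by nra.
have t01 : 0 <= 1 - t <= 1 by lra.
have := bernoulli_ineq (2 * d) t01; rewrite subKr tE subKr ler_pdivrMr// mulrC => b.
apply: (@le_lt_trans _ _ (1 - (1 - (1 - t)) ^+ (2 * d))); last first.
  by rewrite gtrBl exprn_gt0// subKr.
have tk : 0 <= 1 - (1 - (1 - t)) ^+ (2 * d).
  by rewrite subKr subr_ge0 exprn_ile1// ltW.
apply: qc_le_of_theta_gt0 => //.
apply: lt_le_trans (theta_thin_sites Pr_law p01 t01).
apply: (lt_le_trans pp'); apply: theta_mono => //.
by rewrite mulr_ile1 ?exprn_ge0 ?exprn_ile1//; lra.
Qed.

End critical_curve.

(** * Calculus along the critical curve *)

Section calculus.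
Variable R : realType.

(** Let [m] be the supremum of the points [x] with [G a <= G x]. Monotonicity near [m], applied on
    its left, puts [m] in this set; applied on its right, it excludes [m < b]. *)
Lemma locally_nondecreasing_le (G : R -> R) (a b : R) : a <= b ->
  (forall x, a <= x <= b -> exists2 e, 0 < e & forall y z, a <= y -> y < z -> z <= b ->
     x - e < y -> z < x + e -> G y <= G z) ->
  G a <= G b.
Proof.
move=> ab Gloc; pose S := [set x | a <= x <= b /\ G a <= G x].
have Sa : S a by split; rewrite ?lexx.
have Sb : has_ubound S by exists b => x [/andP[]].
pose m := sup S.
have am : a <= m by exact: (ub_le_sup Sb).
have mb : m <= b by apply: ge_sup; [exists a|move=> x [/andP[]]].
have [|e e0 Ge] := Gloc m; first by rewrite am.
have [||x [/andP[ax xb] Gx] mx] := @sup_gt R S (m - e).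
- by exists a.
- by rewrite -/m ltrBlDr ltrDl.
have xm : x <= m by apply: (ub_le_sup Sb); split; rewrite ?ax.
have Gm : G a <= G m.
  move: xm; rewrite le_eqVlt => /orP[/eqP <-//|xm].
  by apply: (le_trans Gx); apply: Ge => //; rewrite ltrDl.
move: mb; rewrite le_eqVlt => /orP[/eqP <-//|mb].
pose y := Num.min b (m + e / 2).
have my : m < y by rewrite lt_min mb ltrDl divr_gt0.
have yb : y <= b by rewrite ge_min lexx.
have Gy : G a <= G y.
  apply: (le_trans Gm); apply: Ge => //; first by rewrite ltrBlDr ltrDl.
  by rewrite gt_min ltrD2l gtr_pMr// invf_lt1// ltr1n orbT.
have : y <= m by apply: (ub_le_sup Sb); split=> //; rewrite yb (le_trans am)// ltW.
by rewrite leNgt my.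
Qed.

(** For [n > 0] the function [h x + I x + 2 * n * (x - a)] is locally nondecreasing: near [x] the
    slopes of [h] are at least [- (g x + n)] and those of the integral [I] at least [g x - n]. Then
    [n] tends to 0. *)
Lemma ge_opp_Rintegral_slope (h g : R -> R) (a b : R) : a < b ->
  {in `[a, b], forall x, {for x, continuous g}} ->
  (forall x k, a <= x <= b -> g x < k -> exists2 e, 0 < e & forall y z,
     a <= y -> y < z -> z <= b -> x - e < y -> z < x + e -> - k * (z - y) <= h z - h y) ->
  - (\int[lebesgue_measure]_(x in `[a, b]) g x) <= h b - h a.
Proof.
move=> ab gc hloc.
have gint c d : a <= c -> d <= b -> (@lebesgue_measure R).-integrable `[c, d] (EFin \o g).
  move=> ac db; apply: continuous_compact_integrable; first exact: segment_compact.
  apply: continuous_in_subspaceT => x; rewrite inE/= in_itv/= => /andP[cx xd].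
  by apply: gc; rewrite in_itv/= (le_trans ac)//= (le_trans xd).
pose I x := \int[lebesgue_measure]_(t in `[a, x]) g t.
have Ia : I a = 0 by rewrite /I set_itv1 Rintegral_set1.
have IB y z : a <= y -> y < z -> z <= b -> I z - I y = \int[lebesgue_measure]_(t in `[y, z]) g t.
  move=> ay yz zb; rewrite /I Rintegral_itvB ?bnd_simp//.
  - by rewrite Rintegral_itv_obnd_cbnd//; apply: integrableS (gint y z ay zb) => //;
      apply: subset_itvr; rewrite bnd_simp.
  - exact: gint.
  - exact: ltW.
suff G (n : R) : 0 < n -> h a + I a + 2 * n * (a - a) <= h b + I b + 2 * n * (b - a).
  rewrite lerNl opprB -subr_ge0 -/(I b).
  apply/ler_addgt0Pl => n n0.
  have n'0 : 0 < n / (2 * (b - a)) by rewrite divr_gt0// mulr_gt0// subr_gt0.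
  have := G _ n'0; rewrite Ia subrr mulr0.
  have -> : 2 * (n / (2 * (b - a))) * (b - a) = n by field; rewrite subr_eq0 gt_eqF.
  lra.
move=> n0; pose G x := h x + I x + 2 * n * (x - a).
apply: (@locally_nondecreasing_le G) => [|x /andP[ax xb]]; first exact: ltW.
have [||e e0 he] := hloc x (g x + n); [by rewrite ax|by rewrite ltrDl|].
have [e' e'0 ge'] : exists2 e', 0 < e' & forall t, `|x - t| < e' -> g x - n < g t.
  have /cvgrPdist_lt/(_ n n0) : g @ x --> g x by apply: gc; rewrite in_itv/= ax.
  move=> /nbhs_ballP[e' e'0 be']; exists e' => // t xt.
  have := be' t xt; rewrite /= ltr_norml; lra.
exists (Num.min e e') => [|y z ay yz zb]; first by rewrite lt_min e0.
move=> xy zx.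
have [xe xe'] : x - e < y /\ x - e' < y.
  by split; apply: le_lt_trans xy; rewrite lerD2l lerN2 ge_min lexx ?orbT.
have [ze ze'] : z < x + e /\ z < x + e'.
  by split; apply: (lt_le_trans zx); rewrite lerD2l ge_min lexx ?orbT.
have h1 := he y z ay yz zb xe ze.
have h2 : (g x - n) * (z - y) <= I z - I y.
  rewrite IB//; apply: (@le_trans _ _ (\int[lebesgue_measure]_(t in `[y, z]) (g x - n))).
    apply: (@le_trans _ _ ((g x - n) * fine (@lebesgue_measure R `[y, z]%classic))).
      by rewrite lebesgue_measure_itv/= lte_fin yz -EFinB.
    by rewrite Rintegral_cst.
  apply: le_Rintegral => //; last 1 first.
  - move=> t /=; rewrite in_itv/= => /andP[yt tz]; apply/ltW/ge'.
    by rewrite ltr_norml; lra.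
  - apply: continuous_compact_integrable; first exact: segment_compact.
    by apply: continuous_subspaceT => t; exact: cvg_cst.
  - exact: gint.
rewrite /G; nra.
Qed.

Lemma derive_along_line (f : R * R -> R) (z v : R * R) (t : R) :
  differentiable f (z + t *: v) ->
  derivable (fun s : R => f (z + s *: v)) t 1 /\
  derive1 (fun s : R => f (z + s *: v)) t = 'd f (z + t *: v) v.
Proof.
move=> df; pose l (s : R) := z + s *: v; have dl : differentiable l t.
  by apply: differentiableD => //; apply: differentiableZl.
split.
  by apply/derivable1_diffP; exact: (@differentiable_comp _ _ _ _ l f t dl df).
transitivity ('D_v f (l t)); last exact: deriveE.
rewrite derive1E /derive; set F := (X in lim (X @ _)).
set G := (X in _ = lim (X @ _)); suff -> : F = G by [].
apply/funext => s; rewrite /F /G /=; congr (_ *: (f _ - _)).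
by rewrite [s%:A]mulr1 /l scalerDl addrCA.
Qed.

End calculus.

Lemma nondecreasing_derive1_ge0 (R : realType) (f : R -> R) (l r a : R) : l < a < r ->
  (forall x y, l < x -> x <= y -> y < r -> f x <= f y) -> derivable f a 1 ->
  0 <= derive1 f a.
Proof.
move=> /andP[la ar] fi df.
apply: limr_ge.
  have := df; rewrite /derivable /= => df'.
  by under eq_fun do rewrite -[X in f (X + a)]mulr1.
have e0 : 0 < Num.min (a - l) (r - a) by rewrite lt_min !subr_gt0 la.
near=> h.
have h0 : h != 0 by near: h; exact: nbhs_dnbhs_neq.
have : `|h| < Num.min (a - l) (r - a).
  near: h; apply: dnbhs0_lt; exact: e0.
rewrite lt_min !ltr_norml => /andP[/andP[h1 h2] /andP[h3 h4]].
have [hp|hn] := ltP 0 h.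
  by rewrite mulr_ge0 ?invr_ge0 ?(ltW hp)// subr_ge0 fi//; lra.
have {}hn : h < 0 by rewrite lt_neqAle h0.
rewrite mulr_le0// ?invr_le0 ?(ltW hn)// subr_le0 fi//; lra.
Unshelve. all: by end_near. Qed.

(** * Derivatives of [theta_n] and variation of [theta] along segments *)

Section slopes.
Variables (R : realType) (d : nat).
Variable Pr : R -> R -> probability (config_space d) R.
Hypothesis Pr_law : site_bond_percolation Pr.

Lemma bern_rates_differentiable s A w (z : R * R) :
  differentiable (fun z : R * R => bern s (@rates R d z.1 z.2) A w) z.
Proof.
elim: s w => [|x s IH] w /=; first exact: differentiable_cst.
have dr : differentiable (fun z : R * R => @rates R d z.1 z.2 x) z.
  rewrite /rates; case: (is_site x).
    by apply: (@linear_differentiable R (R * R)%type R (snd : {linear (R * R)%type -> R}) z) => y;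
      exact: cvg_snd.
  by apply: (@linear_differentiable R (R * R)%type R (fst : {linear (R * R)%type -> R}) z) => y;
    exact: cvg_fst.
apply: differentiableD; apply: differentiableM => //.
by apply: differentiableB => //; exact: differentiable_cst.
Qed.

(** The polynomial extending [theta_n] from the unit square to the whole plane, so that it can be
    differentiated without side conditions on the parameters. *)
Definition arm_poly n (z : R * R) : R :=
  bern (box d n) (rates z.1 z.2) (arm n) (@empty_config d).

Lemma open_squareP (p q : R) : open_square R (p, q) -> [/\ 0 < p, p < 1, 0 < q & q < 1].
Proof. by case; rewrite /= !in_itv/= => /andP[? ?] /andP[? ?]. Qed.

Lemma arm_polyE n (p q : R) : (0 < n)%N -> 0 <= p <= 1 -> 0 <= q <= 1 ->
  arm_poly n (p, q) = theta_n Pr n p q.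
Proof. by move=> n0 p01 q01; rewrite theta_nE. Qed.

Lemma derive1_theta_n_bond n (p q : R) : (0 < n)%N -> open_square R (p, q) ->
  derive1 (fun p' => theta_n Pr n p' q) p = 'd (arm_poly n) (p, q) (1, 0) /\
  0 <= 'd (arm_poly n) (p, q) (1, 0).
Proof.
move=> n0 /open_squareP[p0 p1 q0 q1].
have lE (s : R) : (0, q) + s *: (1, 0) = (s, q) :> R * R.
  by rewrite -[LHS]/(0 + s * 1, q + s * 0) mulr1 mulr0 add0r addr0.
have q01 : 0 <= q <= 1 by rewrite !ltW.
have nearE : \near p, arm_poly n ((0, q) + p *: (1, 0)) = theta_n Pr n p q.
  near=> s; rewrite lE arm_polyE//.
  have : s \in `]0, 1[ by near: s; apply: near_in_itvoo; rewrite in_itv/= p0.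
  by rewrite in_itv/= => /andP[? ?]; rewrite !ltW.
have [dp dE] := @derive_along_line R (arm_poly n) (0, q) (1, 0) p
  (bern_rates_differentiable _ _ _ _).
have E : derive1 (fun p' => theta_n Pr n p' q) p = 'd (arm_poly n) (p, q) (1, 0).
  by rewrite -lE -dE !derive1E; symmetry; exact: near_eq_derive.
split=> //; rewrite -E; apply: (@nondecreasing_derive1_ge0 _ _ 0 1); first by rewrite p0.
  by move=> x y x0 xy y1; apply: le_theta_n => //; exact: ltW.
exact: near_eq_derivable dp.
Unshelve. all: by end_near. Qed.

Lemma derive1_theta_n_site n (p q : R) : (0 < n)%N -> open_square R (p, q) ->
  derive1 (fun q' => theta_n Pr n p q') q = 'd (arm_poly n) (p, q) (0, 1) /\
  0 <= 'd (arm_poly n) (p, q) (0, 1).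
Proof.
move=> n0 /open_squareP[p0 p1 q0 q1].
have lE (s : R) : (p, 0) + s *: (0, 1) = (p, s) :> R * R.
  by rewrite -[LHS]/(p + s * 0, 0 + s * 1) mulr1 mulr0 add0r addr0.
have p01 : 0 <= p <= 1 by rewrite !ltW.
have nearE : \near q, arm_poly n ((p, 0) + q *: (0, 1)) = theta_n Pr n p q.
  near=> s; rewrite lE arm_polyE//.
  have : s \in `]0, 1[ by near: s; apply: near_in_itvoo; rewrite in_itv/= q0.
  by rewrite in_itv/= => /andP[? ?]; rewrite !ltW.
have [dp dE] := @derive_along_line R (arm_poly n) (p, 0) (0, 1) q
  (bern_rates_differentiable _ _ _ _).
have E : derive1 (fun q' => theta_n Pr n p q') q = 'd (arm_poly n) (p, q) (0, 1).
  by rewrite -lE -dE !derive1E; symmetry; exact: near_eq_derive.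
split=> //; rewrite -E; apply: (@nondecreasing_derive1_ge0 _ _ 0 1); first by rewrite q0.
  by move=> x y x0 xy y1; apply: le_theta_n => //; exact: ltW.
exact: near_eq_derivable dp.
Unshelve. all: by end_near. Qed.

(** The last hypothesis is the sign of the derivative of [theta_n] in the direction [(a, b)], so
    every [theta_n] is nonincreasing along the segment. At the end point [theta] is at most
    [theta_n], and [le_theta] passes to the limit at the starting point. *)
Lemma theta_along_line (p q a b T : R) : 0 <= T ->
  (forall s, 0 <= s <= T -> open_square R (p + s * a, q + s * b)) ->
  (forall n s, (0 < n)%N -> 0 <= s <= T ->
     a * derive1 (fun p' => theta_n Pr n p' (q + s * b)) (p + s * a) +
     b * derive1 (fun q' => theta_n Pr n (p + s * a) q') (q + s * b) <= 0) ->
  theta Pr (p + T * a) (q + T * b) <= theta Pr p q.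
Proof.
move=> T0 sq dle; apply: le_theta => // k; set n := k.+1.*2.
have n0 : (0 < n)%N by [].
apply: (le_trans (theta_le_theta_n Pr_law _ _ n0)).
have lE (s : R) : (p, q) + s *: (a, b) = (p + s * a, q + s * b) :> R * R by [].
have line s : 0 <= s <= T ->
    arm_poly n ((p, q) + s *: (a, b)) = theta_n Pr n (p + s * a) (q + s * b).
  move=> /sq/open_squareP[? ? ? ?].
  by rewrite lE arm_polyE// !ltW.
rewrite -line ?T0 ?lexx//.
have := line 0; rewrite !mul0r !addr0 lexx T0 => /(_ isT) <-.
have dl s := @derive_along_line R (arm_poly n) (p, q) (a, b) s (bern_rates_differentiable _ _ _ _).
apply: (@ler0_derive1_le_cc R (fun s : R => arm_poly n ((p, q) + s *: (a, b))) 0 T).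
- by move=> s _; case: (dl s).
- move=> s; rewrite in_itv/= => /andP[s0 sT]; rewrite (dl s).2 lE.
  have s0T : 0 <= s <= T by rewrite !ltW.
  have -> : (a, b) = a *: (1, 0) + b *: (0, 1) :> R * R.
    by rewrite -[RHS]/(a * 1 + b * 0, a * 0 + b * 1) !mulr1 !mulr0 addr0 add0r.
  rewrite linearD !linearZ /= -(derive1_theta_n_bond n0 (sq _ s0T)).1.
  by rewrite -(derive1_theta_n_site n0 (sq _ s0T)).1; exact: dle.
- apply: continuous_subspaceT => s; apply: differentiable_continuous.
  by apply/derivable1_diffP; case: (dl s).
- by rewrite in_itv/= lexx T0.
- by rewrite in_itv/= lexx T0.
- by [].
Qed.

End slopes.

Lemma open_square_open (R : realType) : open (open_square R).
Proof.
rewrite openE => -[p q] [/= p01 q01].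
by exists (`]0, 1[%classic, `]0, 1[%classic) => //; split; exact: near_in_itvoo.
Qed.

Lemma continuous_square_at (R : realType) (f : R * R -> R) (z : R * R) :
  {within open_square R, continuous f} -> open_square R z -> {for z, continuous f}.
Proof.
rewrite continuous_open_subspace; last exact: open_square_open.
by move=> fc zs; apply: fc; rewrite inE.
Qed.

Lemma square_near_lt (R : realType) (f : R * R -> R) (p q k : R) :
  {within open_square R, continuous f} -> open_square R (p, q) -> f (p, q) < k ->
  exists2 r, 0 < r & forall p' q', `|p' - p| < r -> `|q' - q| < r ->
    open_square R (p', q') /\ f (p', q') < k.
Proof.
move=> fc sq fk; have fz := continuous_square_at fc sq.
have near1 : \forall z \near (p, q), f z < k.
  have /cvgrPdist_lt/(_ (k - f (p, q))) := fz; rewrite subr_gt0 => /(_ fk).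
  by apply: filterS => z; rewrite ltr_norml; lra.
have near2 : \forall z \near (p, q), open_square R z.
  by have := @open_square_open R; rewrite openE => /(_ _ sq).
have /nbhs_ballP[r r0 br] : \forall z \near (p, q), open_square R z /\ f z < k.
  by near=> z; split; near: z.
exists r => // p' q' pp' qq'; apply: br; split => /=.
  by rewrite /ball/= distrC.
by rewrite /ball/= distrC.
Unshelve. all: by end_near. Qed.

(** * Local slopes of the critical curve *)

Section critical_curve_slopes.
Variables (R : realType) (d : nat).
Hypothesis d_gt0 : (0 < d)%N.
Variable Pr : R -> R -> probability (config_space d) R.
Hypothesis Pr_law : site_bond_percolation Pr.

(** The factor [(2 * d)%:R / p2] of [qc_increment] at its largest, for [p2 = p0c Pr]. *)
Let lip : R := (2 * d)%:R / p0c Pr.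

Lemma lip_gt0 : 0 < lip.
Proof. by rewrite divr_gt0 ?p0c_gt0// ltr0n muln_gt0. Qed.

Lemma qc_lipschitz (p1 p2 : R) : p0c Pr <= p1 <= 1 -> p0c Pr <= p2 <= 1 ->
  `|qc Pr p1 - qc Pr p2| <= lip * `|p1 - p2|.
Proof.
have pc0 := p0c_gt0 d_gt0 Pr_law.
wlog p12 : p1 p2 / p1 <= p2.
  move=> wl h1 h2; have [p12|p21] := leP p1 p2; first exact: wl.
  by rewrite distrC (distrC p1); apply: wl => //; exact: ltW.
move=> /andP[p1c p11] /andP[p2c p21].
have p10 : 0 < p1 := lt_le_trans pc0 p1c.
have le12 := qc_nonincreasing d_gt0 Pr_law (ltW p10) p12 p21.
rewrite ger0_norm ?subr_ge0// distrC ger0_norm ?subr_ge0//.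
apply: (le_trans (qc_increment d_gt0 Pr_law p10 p12 p21)).
rewrite ler_wpM2r ?subr_ge0// /lip ler_wpM2l// lef_pV2 ?posrE//.
exact: lt_le_trans p2c.
Qed.

Lemma qc_continuous_at (x : R) : p0c Pr < x < 1 -> {for x, continuous (qc Pr)}.
Proof.
move=> /andP[cx x1]; apply/cvgrPdist_lt => e e0.
have l0 := lip_gt0.
near=> y.
have : y \in `]p0c Pr, 1[ by near: y; apply: near_in_itvoo; rewrite in_itv/= cx.
rewrite in_itv/= => /andP[cy y1].
apply: (@le_lt_trans _ _ (lip * `|x - y|)).
  by apply: qc_lipschitz; rewrite !ltW.
rewrite mulrC -ltr_pdivlMr//; near: y.
by exists (e / lip) => //=; rewrite divr_gt0.
Unshelve. all: by end_near. Qed.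

Lemma qc_curve_in_square (x : R) : p0c Pr < x < 1 -> open_square R (x, qc Pr x).
Proof.
move=> /andP[cx x1]; have pc0 := p0c_gt0 d_gt0 Pr_law.
have x0 : 0 < x := lt_trans pc0 cx.
split; rewrite /= in_itv/=; first by rewrite x0.
by rewrite qc_gt0 ?qc_lt1// ?(ltW x0) ltW.
Qed.

(** A window around [x] in which the curve moves by at most [r / 4] and a segment of slope [k] or
    [- k] by at most [r / 4]; this keeps the segments of the slope bounds within [r] of the curve
    point. *)
Lemma qc_near (x r k : R) : p0c Pr < x < 1 -> 0 < r -> 0 < k ->
  exists2 e, 0 < e & [/\ e <= r, 2 * k * e <= r / 4 &
    forall y, x - e < y -> y < x + e -> p0c Pr < y < 1 /\ `|qc Pr y - qc Pr x| <= r / 4].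
Proof.
move=> /andP[cx x1] r0 k0; have l0 := lip_gt0.
(* The last bound gives both [lip * e <= r / 4] and [2 * k * e <= r / 4]; the two middle ones keep
   the window inside []p0c, 1[]. *)
pose e := Num.min (Num.min r (x - p0c Pr)) (Num.min (1 - x) (r / (8 * (lip + k)))).
have e0 : 0 < e.
  by rewrite !lt_min r0 !subr_gt0 cx x1 divr_gt0// mulr_gt0// addr_gt0.
have : e <= e by []; rewrite {2}/e !le_min => /andP[/andP[er ec] /andP[e1]].
have lk : 0 < 8 * (lip + k) by rewrite mulr_gt0// addr_gt0.
rewrite ler_pdivlMr// => elk.
have ek : 0 < e * k by rewrite mulr_gt0.
have el : 0 < e * lip by rewrite mulr_gt0.
exists e => //; split=> //; first by lra.
move=> y ye1 ye2; have yx : p0c Pr < y < 1 by lra.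
split=> //; apply: (@le_trans _ _ (lip * `|y - x|)).
  by case/andP: yx => ? ?; apply: qc_lipschitz; rewrite !ltW.
apply: (@le_trans _ _ (lip * e)); last by lra.
by rewrite ler_wpM2l ?(ltW l0)// ler_norml; lra.
Qed.

(** If the curve fell faster than [k] between [y] and [z], a segment of direction [(1, - k)] would
    start strictly below it and end strictly above it. But [theta_n] is nonincreasing along this
    segment, its derivative being at most [u - k] times the derivative in [q], so percolation at the
    end would force percolation at the start. *)
Lemma qc_slope_ge (u : R * R -> R) (x k : R) :
  {within open_square R, continuous u} -> (forall z, open_square R z -> 0 < u z) ->
  (forall n (p q : R), (1 <= n)%N -> open_square R (p, q) ->
       derive1 (fun p' => theta_n Pr n p' q) p
         <= u (p, q) * derive1 (fun q' => theta_n Pr n p q') q) ->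
  p0c Pr < x < 1 -> u (x, qc Pr x) < k ->
  exists2 e, 0 < e & forall y z, x - e < y -> y < z -> z < x + e ->
    - k * (z - y) <= qc Pr z - qc Pr y.
Proof.
move=> uc u0 udp xc uk.
have k0 : 0 < k := lt_trans (u0 _ (qc_curve_in_square xc)) uk.
have [r r0 sqr] := square_near_lt uc (qc_curve_in_square xc) uk.
have pc0 := p0c_gt0 d_gt0 Pr_law.
have [e e0 [er ke near_x]] := qc_near xc r0 k0.
exists e => // y z xy yz zx.
have [/andP[yc y1] qy] := near_x y xy (lt_trans yz zx).
have [/andP[zc z1] qz] := near_x z (lt_trans xy yz) zx.
rewrite leNgt; apply/negP => zy.
(* The midpoint separates the two sides of [zy]; the maximum with [qc Pr y - r / 4] keeps [q] close
   to the curve. *)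
pose q := Num.max (qc Pr y - r / 4) ((qc Pr y + (qc Pr z + k * (z - y))) / 2).
have q1 : q < qc Pr y by rewrite gt_max; lra.
have q2 : qc Pr z + k * (z - y) < q by rewrite lt_max; lra.
have q3 : qc Pr y - r / 4 <= q by rewrite le_max lexx.
have zy0 : 0 <= z - y by rewrite subr_ge0 ltW.
have kzy : k * (z - y) <= r / 4.
  by apply: le_trans ke; rewrite -mulrA mulrCA ler_wpM2l ?(ltW k0)//; lra.
have line s : 0 <= s <= z - y ->
    open_square R (y + s * 1, q + s * - k) /\ u (y + s * 1, q + s * - k) < k.
  move=> /andP[s0 sz]; move: qy; rewrite ler_norml => /andP[qy1 qy2].
  have ks : 0 <= k * s <= k * (z - y) by rewrite mulr_ge0 ?(ltW k0)//= ler_wpM2l ?(ltW k0).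
  apply: sqr; rewrite ltr_norml; lra.
have := @theta_along_line R d Pr Pr_law y q 1 (- k) (z - y) zy0 (fun s hs => (line s hs).1).
have y01 : 0 <= y <= 1 by rewrite !ltW// (lt_trans pc0).
have z01 : 0 <= z <= 1 by rewrite !ltW// (lt_trans pc0).
have q0 : 0 <= q.
  have [|/open_squareP[_ _ + _] _] := line 0; first by rewrite lexx.
  by rewrite mul0r addr0 => /ltW.
have E1 : y + (z - y) * 1 = z by ring.
have E2 : q + (z - y) * - k = q - k * (z - y) by ring.
rewrite (theta_lt_qc d_gt0 Pr_law y01 q0 q1) E1 E2 => h.
have : 0 < theta Pr z (q - k * (z - y)).
  apply: theta_gt_qc; first by rewrite ltrBrDr.
  have [|/open_squareP[_ _ + +] _] := line (z - y); first by rewrite zy0 lexx.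
  by rewrite E2 => /ltW -> /ltW.
rewrite ltNge; apply/negP; rewrite negbK; apply: h.
move=> n s n0 hs; have [sq us] := line s hs.
have := udp n _ _ n0 sq.
have [Eq q'0] := derive1_theta_n_site Pr_law n0 sq.
move: us; rewrite Eq mul1r mulNr subr_le0 => us /le_trans; apply.
by rewrite ler_wpM2r// ltW.
Qed.

(** Same argument with the direction [(- 1, k)]: the segment runs from below the curve at [z] to
    above it at [y], and the derivative of [theta_n] along it is at most [k * v - 1] times the
    derivative in [p], which is nonpositive since [v < k^-1]. *)
Lemma qc_slope_le (v : R * R -> R) (x k : R) :
  {within open_square R, continuous v} -> (forall z, open_square R z -> 0 < v z) ->
  (forall n (p q : R), (1 <= n)%N -> open_square R (p, q) ->
       derive1 (fun q' => theta_n Pr n p q') q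
         <= v (p, q) * derive1 (fun p' => theta_n Pr n p' q) p) ->
  p0c Pr < x < 1 -> 0 < k -> v (x, qc Pr x) < k^-1 ->
  exists2 e, 0 < e & forall y z, x - e < y -> y < z -> z < x + e ->
    qc Pr z - qc Pr y <= - k * (z - y).
Proof.
move=> vc v0 vdp xc k0 vk.
have [r r0 sqr] := square_near_lt vc (qc_curve_in_square xc) vk.
have pc0 := p0c_gt0 d_gt0 Pr_law.
have [e e0 [er ke near_x]] := qc_near xc r0 k0.
exists e => // y z xy yz zx.
have [/andP[yc y1] qy] := near_x y xy (lt_trans yz zx).
have [/andP[zc z1] qz] := near_x z (lt_trans xy yz) zx.
rewrite leNgt; apply/negP => zy.
pose q := Num.min (qc Pr y + r / 4) ((qc Pr y + (qc Pr z + k * (z - y))) / 2).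
have q1 : qc Pr y < q by rewrite lt_min; lra.
have q2 : q < qc Pr z + k * (z - y) by rewrite gt_min; lra.
have q3 : q <= qc Pr y + r / 4 by rewrite ge_min lexx.
have zy0 : 0 <= z - y by rewrite subr_ge0 ltW.
have kzy : k * (z - y) <= r / 4.
  by apply: le_trans ke; rewrite -mulrA mulrCA ler_wpM2l ?(ltW k0)//; lra.
set q' := q - k * (z - y).
have line s : 0 <= s <= z - y ->
    open_square R (z + s * - 1, q' + s * k) /\ v (z + s * - 1, q' + s * k) < k^-1.
  move=> /andP[s0 sz]; move: qy; rewrite ler_norml => /andP[qy1 qy2].
  have ks : 0 <= k * s <= k * (z - y) by rewrite mulr_ge0 ?(ltW k0)//= ler_wpM2l ?(ltW k0).
  by apply: sqr; rewrite ltr_norml /q'; lra.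
have := @theta_along_line R d Pr Pr_law z q' (- 1) k (z - y) zy0 (fun s hs => (line s hs).1).
have y01 : 0 <= y <= 1 by rewrite !ltW// (lt_trans pc0).
have z01 : 0 <= z <= 1 by rewrite !ltW// (lt_trans pc0).
have q'0 : 0 <= q'.
  have [|/open_squareP[_ _ + _] _] := line 0; first by rewrite lexx.
  by rewrite mul0r addr0 => /ltW.
rewrite (theta_lt_qc d_gt0 Pr_law z01 q'0); last by rewrite /q' ltrBlDr.
have -> : z + (z - y) * - 1 = y by ring.
have E : q' + (z - y) * k = q by rewrite /q'; ring.
rewrite E => h; have : 0 < theta Pr y q.
  apply: theta_gt_qc => //.
  have [|/open_squareP[_ _ + +] _] := line (z - y); first by rewrite zy0 lexx.
  by rewrite E => /ltW -> /ltW.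
rewrite ltNge; apply/negP; rewrite negbK; apply: h.
move=> n s n0 hs; have [sq vs] := line s hs.
have := ler_wpM2l (ltW k0) (vdp n _ _ n0 sq).
have [Ep p'0] := derive1_theta_n_bond Pr_law n0 sq.
rewrite Ep mulN1r => dv; rewrite [leLHS]addrC subr_le0; apply: (le_trans dv).
by rewrite mulrA ler_piMl// mulrC -ler_pdivlMr// mul1r ltW.
Qed.

End critical_curve_slopes.

(** * Monotonicity, Lipschitz regularity and integral bounds *)

Theorem theorem2p7 (R : realType) (d : nat) (d_gt0 : (0 < d)%N)
    (Pr : R -> R -> probability (config_space d) R)
    (Pr_law : site_bond_percolation Pr)
    (u v : R * R -> R)
    (u_cont : {within open_square R, continuous u})
    (v_cont : {within open_square R, continuous v})
    (u_gt0 : forall z, open_square R z -> 0 < u z)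
    (v_gt0 : forall z, open_square R z -> 0 < v z)
    (le_dp : forall (n : nat) (p q : R), (1 <= n)%N ->
       open_square R (p, q) ->
       derive1 (fun p' => theta_n Pr n p' q) p
         <= u (p, q) * derive1 (fun q' => theta_n Pr n p q') q)
    (le_dq : forall (n : nat) (p q : R), (1 <= n)%N ->
       open_square R (p, q) ->
       derive1 (fun q' => theta_n Pr n p q') q
         <= v (p, q) * derive1 (fun p' => theta_n Pr n p' q) p) :
  [/\ forall p, p0c Pr <= p <= 1 -> 0 <= qc Pr p <= 1,
      forall p1 p2, p0c Pr <= p1 -> p1 < p2 -> p2 <= 1 ->
        qc Pr p2 < qc Pr p1,
      [locally [lipschitz (qc Pr p) | p in `[p0c Pr, 1]%classic]],
      {within `[p0c Pr, 1], continuous (qc Pr)} &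
      forall p1 p2, p0c Pr < p1 -> p1 < p2 -> p2 < 1 ->
        - (\int[lebesgue_measure]_(p in `[p1, p2]) u (p, qc Pr p))
          <= qc Pr p2 - qc Pr p1
        /\ qc Pr p2 - qc Pr p1
          <= - (\int[lebesgue_measure]_(p in `[p1, p2]) (v (p, qc Pr p))^-1)].
Proof.
have pc0 := p0c_gt0 d_gt0 Pr_law.
have curve := qc_curve_in_square d_gt0 Pr_law.
have qcc := qc_continuous_at d_gt0 Pr_law.
have lip : forall p1 p2, p0c Pr <= p1 <= 1 -> p0c Pr <= p2 <= 1 -> _ := qc_lipschitz d_gt0 Pr_law.
split.
- move=> p /andP[cp p1]; have p01 : 0 <= p <= 1 by rewrite (le_trans (ltW pc0) cp).
  by rewrite qc_le1// ltW// qc_gt0.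
- move=> p1 p2; rewrite le_eqVlt => /orP[/eqP <- cp2 p21|cp1 p12 p21].
    (* The slope bounds concern interior points only; at the left end [qc] is 1, and it is below 1
       beyond. *)
    by rewrite (qc_p0c d_gt0 Pr_law) qc_lt1.
  have p1c : p0c Pr < p1 < 1 by rewrite cp1 (lt_le_trans p12).
  have vp := v_gt0 _ (curve _ p1c).
  (* Any positive [k] with [v < k^-1] at the curve point would do. *)
  have k0 : 0 < (v (p1, qc Pr p1) + 1)^-1 by rewrite invr_gt0 addr_gt0.
  have [|e e0 slope] := qc_slope_le d_gt0 Pr_law v_cont v_gt0 le_dq p1c k0.
    by rewrite invrK ltrDl.
  (* Strict decrease on the short interval from [p1] to [z], then monotonicity up to [p2]. *)
  pose z := Num.min p2 (p1 + e / 2).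
  have p1z : p1 < z by rewrite lt_min p12 ltrDl divr_gt0.
  have zp2 : z <= p2 by rewrite ge_min lexx.
  have ze : z < p1 + e by rewrite gt_min ltrD2l gtr_pMr// invf_lt1// ltr1n orbT.
  have p1e : p1 - e < p1 by rewrite ltrBlDr ltrDl.
  have z0 : 0 <= z by rewrite ltW// (lt_trans pc0)// (lt_trans cp1).
  apply: le_lt_trans (qc_nonincreasing d_gt0 Pr_law z0 zp2 p21) _.
  rewrite -subr_lt0; apply: le_lt_trans (slope p1 z p1e p1z ze) _.
  by rewrite mulNr oppr_lt0 mulr_gt0// subr_gt0.
- apply: lipschitz_locally.
  apply: (@klipschitzW _ _ _ ((2 * d)%:R / p0c Pr)).
    apply: (@globally_properfilter _ _ (1, 1)).
    by split; rewrite /= in_itv/= lexx p0c_le1.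
  move=> [x y] /= [] /=; rewrite !in_itv/= => xc yc; exact: lip.
- apply/subspace_continuousP => x; rewrite /= in_itv/= => xc.
  apply/cvgrPdist_lt => e e0.
  have l0 := lip_gt0 d_gt0 Pr_law; set l := (2 * d)%:R / p0c Pr in l0.
  rewrite /prop_near1 /nbhs/= /within/=.
  near=> y => yc; apply: le_lt_trans (lip x y xc yc) _.
  rewrite -/l mulrC -ltr_pdivlMr//; near: y.
  by exists (e / l) => //=; rewrite divr_gt0.
move=> p1 p2 cp1 p12 p21.
have inside x : p1 <= x <= p2 -> p0c Pr < x < 1.
  by move=> /andP[? ?]; rewrite (lt_le_trans cp1)//= (le_lt_trans _ p21).
have comp_cont (f : R * R -> R) x : {within open_square R, continuous f} ->
    p1 <= x <= p2 -> {for x, continuous (fun p => f (p, qc Pr p))}.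
  move=> fc xp; have xc := inside x xp.
  apply: (@continuous_comp _ _ _ (fun p => (p, qc Pr p)) f).
    exact: (@cvg_pair _ _ _ _ (nbhs x) (nbhs (qc Pr x)) _ _ _ id (qc Pr) cvg_id (qcc x xc)).
  by apply: continuous_square_at => //; exact: curve.
split.
  apply: (@ge_opp_Rintegral_slope R (qc Pr) (fun p => u (p, qc Pr p))) => //.
    by move=> x; rewrite in_itv/= => xp; exact: comp_cont.
  move=> x k xp uk.
  have [e e0 slope] := qc_slope_ge d_gt0 Pr_law u_cont u_gt0 le_dp (inside x xp) uk.
  by exists e => // y z _ yz _ xy zx; exact: slope.
(* The upper bound on the increment of [qc] is the lower bound for [- qc] with integrand
   [- 1 / v]. *)
pose g p := - (v (p, qc Pr p))^-1.
have gc : {in `[p1, p2], forall x, {for x, continuous g}}.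
  move=> x; rewrite in_itv/= => xp; apply: continuousN.
  apply: (@continuousV _ _ _ x); first by rewrite gt_eqF// v_gt0//; exact/curve/inside.
  exact: comp_cont.
have -> : - (\int[lebesgue_measure]_(p in `[p1, p2]) (v (p, qc Pr p))^-1) =
    \int[lebesgue_measure]_(p in `[p1, p2]) g p.
  have vint : (@lebesgue_measure R).-integrable `[p1, p2] (EFin \o (fun p => (v (p, qc Pr p))^-1)).
    apply: continuous_compact_integrable; first exact: segment_compact.
    apply: continuous_in_subspaceT => x; rewrite inE/= in_itv/= => xp.
    apply: (@continuousV _ _ _ x); first by rewrite gt_eqF// v_gt0//; exact/curve/inside.
    exact: comp_cont.
  under [RHS]eq_Rintegral do rewrite /g -mulN1r.
  by rewrite RintegralZl// mulN1r.
rewrite -lerN2 (_ : - (qc Pr p2 - qc Pr p1) = (- qc Pr p2) - (- qc Pr p1)); last by ring.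
apply: (@ge_opp_Rintegral_slope R (fun p => - qc Pr p) g) => //.
move=> x k xp gk; have xc := inside x xp.
have vx := v_gt0 _ (curve x xc).
(* A nonnegative [k] is settled by monotonicity of [qc]; otherwise [- k] is positive and
   [v < (- k)^-1], so the upper slope bound applies. *)
have [k0|k0] := leP 0 k.
  exists 1 => // y z py yz zp _ _.
  have y0 : 0 <= y by rewrite ltW// (lt_trans pc0)// (lt_le_trans cp1).
  have := qc_nonincreasing d_gt0 Pr_law y0 (ltW yz) (le_trans zp (ltW p21)).
  have : 0 <= k * (z - y) by rewrite mulr_ge0// subr_ge0 ltW.
  by rewrite mulNr; lra.
have [||e e0 slope] := @qc_slope_le R d d_gt0 Pr Pr_law v x (- k) v_cont v_gt0 le_dq xc.
- by rewrite oppr_gt0.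
- rewrite -[ltLHS]invrK ltf_pV2 ?posrE ?oppr_gt0 ?invr_gt0//.
  by rewrite ltrNl.
exists e => // y z _ yz _ xy zx; have := slope y z xy yz zx.
by rewrite opprK mulNr; lra.
Unshelve. all: by end_near. Qed.
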